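(* For every compact set $K\subset\mathbb{C}$ such that $\mathbb{C}\setminus K$ is connected, $$\partial K=\mathcal{P}(A(K))=M(A(K))=\Gamma(A(K)).$$
   Context: $A(K)$ is the uniform algebra (with the sup norm $\|\cdot\|$ on $K$) of all complex-valued functions continuous on $K$ and holomorphic on $\mathrm{int}(K)$; $\partial K$ is the topological boundary of $K$ in $\mathbb{C}$. $\mathcal{P}(A(K))$ is the set of peak points for $A(K)$, i.e. of $z\in K$ for which there is $f\in A(K)$ with $f(z)=1$ and $|f(w)|<1$ for all $w\in K\setminus\{z\}$. For $f\in A(K)$ put $M_f=\{z\in K: |f(z)|=\|f\|\}$. A closed subset $S\subset K$ is a boundary for $A(K)$ in the Shilov sense if $M_f\cap S\neq\emptyset$ for every $f\in A(K)$; the Shilov boundary $\Gamma(A(K))$ is the intersection of all boundaries for $A(K)$ in the Shilov sense (it is known to be itself such a boundary). A subset $N\subset K$ (not necessarily closed) is a boundary for $A(K)$ in the Bishop sense if $M_f\cap N\neq\emptyset$ for every $f\in A(K)$; the Bishop minimal boundary $M(A(K))$ is the smallest (with respect to inclusion) boundary for $A(K)$ in the Bishop sense (it is known to exist). *)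

(* Defs.v *)
(* The complex plane is [R[i]^o] for [R : realType], with
   the norm topology of the numFieldType [R[i]]. *)
From mathcomp Require Import all_boot all_order all_algebra.
From mathcomp Require Import all_classical all_reals all_analysis.
From mathcomp Require Import complex.

Set Implicit Arguments.
Unset Strict Implicit.
Unset Printing Implicit Defensive.

Import Order.TTheory GRing.Theory Num.Theory numFieldNormedType.Exports.
Local Open Scope classical_set_scope.
Local Open Scope ring_scope.
Local Open Scope complex_scope.

(* [`|z|] on [R[i]] takes its values in [R[i]]; [cmod z] is the same modulus as
   an element of [R], where suprema are available. *)
Definition cmod (R : realType) (z : R[i]) : R := Normc.normc z.

Definition frontier (T : topologicalType) (A : set T) : set T :=
  closure A `\` A°.

(* Elements of A(K) are represented by total functions whose values outside K
   are irrelevant: every notion below depends on the restriction to K only.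
   Since scalars and source are both the complex field, [derivable f z 1] is
   complex differentiability at z. *)
Definition alg_A (R : realType) (K : set R[i]^o) : set (R[i]^o -> R[i]^o) :=
  [set f | {within K, continuous f} /\ forall z, K° z -> derivable f z 1].

Definition sup_norm (R : realType) (K : set R[i]^o) (f : R[i]^o -> R[i]^o) : R :=
  sup [set cmod (f z) | z in K].

Definition max_set (R : realType) (K : set R[i]^o) (f : R[i]^o -> R[i]^o) :
    set R[i]^o :=
  [set z | K z /\ cmod (f z) = sup_norm K f].

Definition peak_points (R : realType) (K : set R[i]^o) : set R[i]^o :=
  [set z | K z /\ exists f, [/\ alg_A K f, f z = 1 &
     forall w, K w -> w <> z -> cmod (f w) < 1]].

Definition bishop_boundary (R : realType) (K N : set R[i]^o) : Prop :=
  N `<=` K /\ forall f, alg_A K f -> max_set K f `&` N !=set0.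

(* For K compact, closed in K and closed in the plane are the same. *)
Definition shilov_sense_boundary (R : realType) (K S : set R[i]^o) : Prop :=
  [/\ closed S, S `<=` K & forall f, alg_A K f -> max_set K f `&` S !=set0].

Definition shilov_boundary (R : realType) (K : set R[i]^o) : set R[i]^o :=
  \bigcap_(S in [set S | shilov_sense_boundary K S]) S.

(* M is the smallest boundary in the Bishop sense; such an M is unique. *)
Definition is_bishop_minimal_boundary (R : realType) (K M : set R[i]^o) : Prop :=
  bishop_boundary K M /\ forall N, bishop_boundary K N -> M `<=` N.

(* Main.v *)
Require Import Defs.
From mathcomp Require Import all_boot all_order all_algebra.
From mathcomp Require Import all_classical all_reals all_analysis.
From mathcomp Require Import complex ring lra.
Set Implicit Arguments.
Unset Strict Implicit.
Unset Printing Implicit Defensive.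
Import Order.TTheory GRing.Theory Num.Theory numFieldNormedType.Exports.
Local Open Scope classical_set_scope.
Local Open Scope ring_scope.
Local Open Scope complex_scope.

(* The maximum principle shows that the frontier is a boundary and that interior
   points are not peak points; for functions that are merely differentiable it
   follows from Goursat's bisection argument, carried out on midpoint sums
   instead of contour integrals.

   Conversely let [z0] be a frontier point.  Choose [a] outside [K] very close to
   [z0].  As the complement of [K] is connected and unbounded, [a] is joined
   outside [K] to a point [b] at distance about [d], by a chain staying
   [d]-close to [a]; off this chain [w = sqrt ((z - a) / (z - b))] has a branch
   tending to [1] at infinity.  Then [(1 - w) / (1 + w)] is bounded on [K] by an
   absolute constant, is close to [1] at [z0] and small at distance at least
   [7 d] from [z0].  Summing such functions with geometric weights, for [d]
   decreasing fast enough, yields a function in A(K) peaking at [z0]; the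
   sum is in A(K) since uniform limits of holomorphic functions are holomorphic,
   by a Schwarz lemma deduced from the maximum principle. *)

Local Notation Re := complex.Re.
Local Notation Im := complex.Im.

(** * The modulus and epsilon-delta characterizations *)

Section Modulus.
Context {R : realType}.
Implicit Types z w : R[i].

Lemma cmodE z : `|z| = (cmod z)%:C. Proof. by []. Qed.
Lemma cmod_ge0 z : 0 <= cmod z.
Proof. by rewrite -ler0c -cmodE. Qed.
Lemma cmod0 : cmod (0 : R[i]) = 0. Proof. exact: Normc.normc0. Qed.
Lemma cmod1 : cmod (1 : R[i]) = 1. Proof. exact: Normc.normc1. Qed.
Lemma cmodM z w : cmod (z * w) = cmod z * cmod w.
Proof. exact: Normc.normcM. Qed.
Lemma cmodV z : cmod z^-1 = (cmod z)^-1.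
Proof. exact: Normc.normcV. Qed.
Lemma cmodN z : cmod (- z) = cmod z.
Proof. by apply: complexI; rewrite -!cmodE normrN. Qed.
Lemma cmodX z n : cmod (z ^+ n) = cmod z ^+ n.
Proof. by elim: n => [|n IH]; rewrite ?expr0 ?cmod1 // !exprS cmodM IH. Qed.
Lemma cmodD z w : cmod (z + w) <= cmod z + cmod w.
Proof. by rewrite -lecR rmorphD /= -!cmodE ler_normD. Qed.
Lemma cmodB z w : cmod (z - w) <= cmod z + cmod w.
Proof. by rewrite -(cmodN w) cmodD. Qed.
Lemma cmodC z w : cmod (z - w) = cmod (w - z).
Proof. by rewrite -opprB cmodN. Qed.
Lemma cmod_lb z w : cmod z - cmod w <= cmod (z + w).
Proof. by have := cmodB (z + w) w; rewrite addrK; lra. Qed.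
Lemma cmod_tri (a b c : R[i]) : cmod (a - c) <= cmod (a - b) + cmod (b - c).
Proof. by rewrite -(subrK b a) -addrA; apply: le_trans (cmodD _ _) _; rewrite (subrK b a). Qed.
Lemma cmod_real (x : R) : 0 <= x -> cmod x%:C = x.
Proof. by move=> x0; apply: complexI; rewrite -cmodE ger0_norm // ler0c. Qed.
Lemma cmod2 : cmod (2 : R[i]) = 2.
Proof. by rewrite -(rmorph_nat (real_complex R)) cmod_real. Qed.
Lemma cmod_eq0 z : (cmod z == 0) = (z == 0).
Proof.
by apply/eqP/eqP => [|->]; [exact: Normc.eq0_normc|exact: cmod0].
Qed.
Lemma cmod_gt0 z : (0 < cmod z) = (z != 0).
Proof. by rewrite lt_def cmod_ge0 andbT cmod_eq0. Qed.
Lemma cmod_i : cmod ('i%C : R[i]) = 1.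
Proof. by rewrite /cmod /= expr0n expr1n add0r sqrtr1. Qed.
Lemma cmod_sq z : cmod z ^+ 2 = Re z ^+ 2 + Im z ^+ 2.
Proof. by apply: complexI; rewrite add_Re2_Im2 rmorphXn. Qed.
Lemma Re_le_cmod z : `|Re z| <= cmod z.
Proof. by rewrite -lecR; exact: normc_ge_Re. Qed.
Lemma Im_le_cmod z : `|Im z| <= cmod z.
Proof.
rewrite -(ler_pXn2r (n := 2)) ?nnegrE ?cmod_ge0 ?normr_ge0 //.
by rewrite real_normK ?num_real // cmod_sq; have := sqr_ge0 (Re z); lra.
Qed.
Lemma cmod_le_ReIm z : cmod z <= `|Re z| + `|Im z|.
Proof.
rewrite -(ler_pXn2r (n := 2)) ?nnegrE ?cmod_ge0 ?addr_ge0 //.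
rewrite cmod_sq sqrrD !real_normK ?num_real //.
have : 0 <= `|Re z| * `|Im z| by rewrite mulr_ge0.
by lra.
Qed.
Lemma cmod_sum (I : Type) (s : seq I) (F : I -> R[i]) :
  cmod (\sum_(i <- s) F i) <= \sum_(i <- s) cmod (F i).
Proof.
elim: s => [|i s IH]; first by rewrite !big_nil cmod0.
by rewrite !big_cons (le_trans (cmodD _ _)) // lerD2l.
Qed.
End Modulus.

(** * Topological notions in terms of the real-valued modulus *)

Section Bridge.
Context {R : realType}.
Implicit Types (z w : R[i]) (K : set R[i]^o) (f g : R[i]^o -> R[i]^o).

Lemma gt0_cmodP (e : R[i]) : 0 < e -> exists2 x : R, 0 < x & e = x%:C.
Proof.
move=> e0; exists (cmod e); first by rewrite cmod_gt0 gt_eqF.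
by rewrite -cmodE gtr0_norm.
Qed.

Lemma nbhs_cmodP (z : R[i]^o) (A : set R[i]^o) :
  nbhs z A <-> exists2 r : R, 0 < r & forall w, cmod (w - z) < r -> A w.
Proof.
split.
  move=> /nbhs_ballP[e /= /gt0_cmodP[r r0 ->]] zA; exists r => // w wz; apply: zA.
  by rewrite /ball /= cmodE ltcR cmodC.
move=> [r r0 rA]; apply/nbhs_ballP; exists r%:C => /=; first by rewrite ltcR.
by move=> w; rewrite /ball /= cmodE ltcR cmodC; exact: rA.
Qed.

Lemma within_continuousP K f :
  {within K, continuous f} <->
  forall z, K z -> forall e : R, 0 < e -> exists2 r : R, 0 < r &
    forall w, K w -> cmod (w - z) < r -> cmod (f w - f z) < e.
Proof.
split=> [/subspace_continuousP cf z Kz e e0|cf].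
  have /(cf _ Kz) : nbhs (f z) [set y | cmod (y - f z) < e].
    by apply/nbhs_cmodP; exists e.
  rewrite /nbhs /= /within /= => /nbhs_cmodP[r r0 rA]; exists r => // w Kw wz.
  exact: rA.
apply/subspace_continuousP => z Kz A /nbhs_cmodP[e e0 eA].
have [r r0 rK] := cf z Kz e e0.
rewrite /nbhs /= /within /=; apply/nbhs_cmodP; exists r => // w wz Kw.
by apply: eA; apply: rK.
Qed.

Lemma interior_cmodP K z :
  (K : set R[i]^o)° z <-> exists2 r : R, 0 < r & forall w, cmod (w - z) < r -> K w.
Proof. exact: nbhs_cmodP. Qed.

(** Multiplying the difference quotient out removes the division, so that [w = z] is an allowed
    point and error terms can simply be added. *)
Lemma derivable_cmodP f z :
  derivable f z 1 <-> exists d : R[i], forall e : R, 0 < e ->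
    exists2 r : R, 0 < r & forall w, cmod (w - z) < r ->
      cmod (f w - f z - d * (w - z)) <= e * cmod (w - z).
Proof.
split.
  move=> /cvg_ex[d /= fd]; exists d => e e0.
  have /fd : nbhs (d : R[i]^o) [set y : R[i]^o | cmod (y - d) < e].
    by apply/nbhs_cmodP; exists e.
  rewrite /nbhs /= /dnbhs /within /= => /nbhs_cmodP[r r0 rA]; exists r => // w wz.
  have [->|wz0] := eqVneq w z; first by rewrite !subrr mulr0 subr0 cmod0 mulr0.
  have := rA (w - z); rewrite subr0 => /(_ wz); rewrite subr_eq0 => /(_ wz0).
  rewrite /= /GRing.scale /= mulr1 subrK => /ltW dwe.
  rewrite (_ : _ - _ = ((w - z)^-1 * (f w - f z) - d) * (w - z)); last first.
    by field; rewrite subr_eq0.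
  by rewrite cmodM ler_wpM2r // cmod_ge0.
move=> [d fd]; apply/cvg_ex; exists d => A /nbhs_cmodP[e e0 eA].
have [r r0 rA] := fd (e / 2) (divr_gt0 e0 (ltr0Sn _ _)).
rewrite /nbhs /= /dnbhs /within /=; apply/nbhs_cmodP; exists r => // h.
rewrite subr0 => hr h0; apply: eA; rewrite /= /GRing.scale /= mulr1.
have := rA (h + z); rewrite addrK => /(_ hr) hh.
rewrite -(ltr_pM2r (x := cmod h)) ?cmod_gt0 // -cmodM.
rewrite (_ : _ * h = f (h + z) - f z - d * h); last by field.
by apply: le_lt_trans hh _; rewrite ltr_pM2r ?cmod_gt0 //; lra.
Qed.

Lemma compact_cmod_max K (g : R[i]^o -> R) : K !=set0 -> compact K ->
  (forall z, K z -> forall e : R, 0 < e -> exists2 r : R, 0 < r &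
    forall w, K w -> cmod (w - z) < r -> `|g w - g z| < e) ->
  exists2 c, K c & forall z, K z -> g z <= g c.
Proof.
move=> K0 cK cg.
have cg' : {within K, continuous g}.
  apply/subspace_continuousP => z Kz A /nbhs_ballP[e /= e0 eA].
  have [r r0 rK] := cg z Kz e e0.
  rewrite /nbhs /= /within /=; apply/nbhs_cmodP; exists r => // w wz Kw.
  by apply: eA; rewrite /ball /= distrC; apply: rK.
have [c /set_mem Kc cmax] := compact_EVT_max K0 cK cg'.
by exists c => // z Kz; apply: cmax; exact: mem_set.
Qed.

Lemma compact_cmod_bounded K : compact K ->
  exists2 B : R, 0 < B & forall z, K z -> cmod z < B.
Proof.
have [->|/set0P K0 cK] := eqVneq K set0; first by exists 1.
have [|c Kc cmax] := @compact_cmod_max K (fun z => cmod z) K0 cK.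
  move=> z Kz e e0; exists e => // w Kw; apply: le_lt_trans.
  by rewrite ler_norml; have := cmod_tri w z 0; have := cmod_tri z w 0;
    rewrite !subr0 (cmodC z w); lra.
by exists (cmod c + 1); [have := cmod_ge0 c; lra|move=> z /cmax; lra].
Qed.

Lemma closed_cmodP K : closed K <->
  forall z, ~ K z -> exists2 r : R, 0 < r & forall w, cmod (w - z) < r -> ~ K w.
Proof.
split=> [|cK].
  rewrite -openC openE => oK z nKz; have /nbhs_cmodP := oK z nKz; exact.
by rewrite -openC openE => z nKz; apply/nbhs_cmodP; exact: cK.
Qed.

Lemma compact_closed_cmod K : compact K -> closed K.
Proof. by apply: compact_closed; exact: norm_hausdorff. Qed.
End Bridge.

(** * The algebra A(K) *)

Section AlgA.
Context {R : realType}.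
Implicit Types (z w : R[i]) (K : set R[i]^o) (f g : R[i]^o -> R[i]^o).

Lemma alg_A_cst K (c : R[i]) : alg_A K (fun=> c).
Proof.
split=> [|z _]; last exact: derivable_cst.
by apply/within_continuousP => z _ e e0; exists 1 => // w _ _; rewrite subrr cmod0.
Qed.

Lemma alg_A_id K : alg_A K (fun z => z).
Proof.
split=> [|z _]; last exact: derivable_id.
by apply/within_continuousP => z _ e e0; exists e.
Qed.

Lemma alg_A_add K f g : alg_A K f -> alg_A K g -> alg_A K (fun z => f z + g z).
Proof.
move=> [cf df] [cg dg]; split=> [|z Kz].
  by move=> z; apply: cvgD; [exact: cf|exact: cg].
by apply: derivableD; [exact: df|exact: dg].
Qed.

Lemma alg_A_mul K f g : alg_A K f -> alg_A K g -> alg_A K (fun z => f z * g z).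
Proof.
move=> [cf df] [cg dg]; split=> [|z Kz].
  by move=> z; apply: cvgM; [exact: cf|exact: cg].
by apply: derivableM; [exact: df|exact: dg].
Qed.

Lemma alg_A_opp K f : alg_A K f -> alg_A K (fun z => - f z).
Proof.
move=> /(alg_A_mul (alg_A_cst K (-1))); congr alg_A.
by apply/funext => z; rewrite mulN1r.
Qed.

Lemma alg_A_sub K f g : alg_A K f -> alg_A K g -> alg_A K (fun z => f z - g z).
Proof. by move=> Kf /alg_A_opp; exact: alg_A_add. Qed.

Lemma derivable_exp f n (z : R[i]^o) : derivable f z 1 -> derivable (fun w : R[i]^o => f w ^+ n) z 1.
Proof.
move=> df; elim: n => [|n IH]; first exact: derivable_cst.
pose g (w : R[i]^o) : R[i]^o := f w ^+ n.
have -> : (fun w : R[i]^o => f w ^+ n.+1) = f * g.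
  by apply/funext => w; rewrite exprS.
exact: (derivableM df IH).
Qed.

Lemma alg_A_exp K f n : alg_A K f -> alg_A K (fun z => f z ^+ n).
Proof.
move=> Kf; elim: n => [|n IH]; first exact: alg_A_cst.
by under eq_fun do rewrite exprS; exact: alg_A_mul.
Qed.

Lemma alg_A_inv K f : alg_A K f -> (forall z, K z -> f z != 0) ->
  alg_A K (fun z => (f z)^-1).
Proof.
move=> [cf df] f0; split=> [|z Kz].
  apply/subspace_continuousP => z Kz; apply: cvgV; first exact: f0.
  by move/subspace_continuousP : cf; exact.
by apply: derivableV; [apply: f0; exact: interior_subset|exact: df].
Qed.

Lemma alg_A_sub_set K L f : L `<=` K -> alg_A K f -> alg_A L f.
Proof.
move=> LK [cf df]; split; first exact: continuous_subspaceW cf.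
by move=> z /(interiorS LK); exact: df.
Qed.

Lemma derivable_continuous_cmod f z : derivable f z 1 ->
  forall e : R, 0 < e -> exists2 r : R, 0 < r &
    forall w, cmod (w - z) < r -> cmod (f w - f z) < e.
Proof.
move=> /derivable_cmodP[d /(_ 1 ltr01)[r r0 fd]] e e0.
have d0 := cmod_ge0 d.
exists (Num.min r (e / (1 + cmod d))).
  by rewrite lt_min r0 divr_gt0 //; lra.
move=> w; rewrite lt_min => /andP[/fd]; rewrite mul1r => wd.
rewrite ltr_pdivlMr; last lra.
have := cmod_lb (f w - f z) (- (d * (w - z))); rewrite cmodN cmodM.
by move: wd; nra.
Qed.

Lemma alg_A_derivable K f : (forall z, K z -> derivable f z 1) -> alg_A K f.
Proof.
move=> df; split=> [|z /interior_subset]; last exact: df.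
apply/within_continuousP => z Kz e e0.
by have [r r0 fr] := derivable_continuous_cmod (df z Kz) e0; exists r => // w _; exact: fr.
Qed.

Lemma alg_A_cmod_max K f : K !=set0 -> compact K -> alg_A K f ->
  exists2 c, K c & forall z, K z -> cmod (f z) <= cmod (f c).
Proof.
move=> K0 cK [/within_continuousP cf _]; apply: compact_cmod_max => // z Kz e e0.
have [r r0 fr] := cf z Kz e e0; exists r => // w Kw /(fr w Kw).
apply: le_lt_trans; rewrite ler_norml.
by have := cmod_tri (f w) (f z) 0; have := cmod_tri (f z) (f w) 0;
  rewrite !subr0 (cmodC (f z) (f w)); lra.
Qed.
End AlgA.

(** * Discrete contour sums and the maximum principle *)

Section Contour.
Context {R : realType}.
Implicit Types (p d z w c : R[i]) (f g : R[i]^o -> R[i]^o) (m n : nat).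

Definition midpt m j : R := (j%:R + 2^-1) / m%:R.

(* Midpoint rule for the integral of [f] along the segment from [p] to [p + d]. *)
Definition edge m f p d : R[i] :=
  d * (m%:R^-1)%:C * \sum_(j < m) f (p + d * (midpt m j)%:C).

(** Discrete integral along the positively oriented square with corners [p], [p + d],
    [p + d + 'i * d], [p + 'i * d]. As [d] is complex, rotated squares are included. *)
Definition contour m f p d : R[i] :=
  edge m f p d + edge m f (p + d) ('i%C * d) - edge m f (p + 'i%C * d) d
  - edge m f p ('i%C * d).

Definition in_square p d z := exists x y : R,
  [/\ 0 <= x <= 1, 0 <= y <= 1 & z = p + d * (x +i* y)].

Lemma midpt_itv m (j : 'I_m) : 0 <= midpt m j <= 1.
Proof.
have m0 : (0 : R) < m%:R by rewrite ltr0n (leq_ltn_trans _ (ltn_ord j)).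
have jm : (j%:R + 1 : R) <= m%:R by rewrite natr1 ler_nat ltn_ord.
have j0 : (0 : R) <= j%:R by rewrite ler0n.
by rewrite /midpt divr_ge0 ?ler_pdivrMr ?mul1r //=; lra.
Qed.

(** The midpoints for [m + m] pieces of a segment are exactly those for [m] pieces of each half.
    Bisection is therefore an exact identity between finite sums. *)
Lemma edge_double m f p d :
  edge (m + m) f p d = edge m f p (d / 2) + edge m f (p + d / 2) (d / 2).
Proof.
case: m => [|m]; first by rewrite /edge !big_ord0 !mulr0 addr0.
have [M ME] : exists M : R, M = m.+1%:R by eexists.
have M0 : M != 0 by rewrite ME pnatr_eq0.
have M20 : M + M != 0 by rewrite ME -natrD pnatr_eq0.
have d2 : (d * ((m.+1 + m.+1)%:R^-1)%:C) = d / 2 * (m.+1%:R^-1)%:C.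
  have -> : ((m.+1 + m.+1)%:R^-1 : R) = 2^-1 * m.+1%:R^-1.
    by rewrite natrD -ME; field; rewrite M0.
  by rewrite rmorphM /= fmorphV rmorph_nat mulrA.
rewrite /edge d2 -mulrDr; congr (_ * _).
rewrite big_split_ord /=; congr (_ + _); apply: eq_bigr => j _; congr (f _).
  have -> : midpt (m.+1 + m.+1) j = 2^-1 * midpt m.+1 j.
    by rewrite /midpt natrD -ME; field; rewrite M0.
  by rewrite rmorphM /= fmorphV rmorph_nat mulrA.
have -> : midpt (m.+1 + m.+1) (m.+1 + j) = 2^-1 * (1 + midpt m.+1 j).
  by rewrite /midpt !natrD -ME; field; rewrite M0.
by rewrite rmorphM rmorphD /= fmorphV rmorph_nat rmorph1; ring.
Qed.

(** The sums along the inner edges of the four quarters cancel exactly. *)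
Lemma contour_double m f p d :
  contour (m + m) f p d = contour m f p (d / 2) + contour m f (p + d / 2) (d / 2)
    + contour m f (p + 'i%C * (d / 2)) (d / 2)
    + contour m f (p + d / 2 + 'i%C * (d / 2)) (d / 2).
Proof.
rewrite /contour !edge_double -!mulrA.
rewrite (_ : p + d + 'i%C * (d / 2) = p + d / 2 + 'i%C * (d / 2) + d / 2); last by field.
rewrite (_ : p + d = p + d / 2 + d / 2); last by field.
rewrite (_ : p + 'i%C * d + d / 2 = p + d / 2 + 'i%C * (d / 2) + 'i%C * (d / 2));
  last by field.
rewrite (_ : p + 'i%C * d = p + 'i%C * (d / 2) + 'i%C * (d / 2)); last by field.
rewrite (_ : p + 'i%C * (d / 2) + d / 2 = p + d / 2 + 'i%C * (d / 2)); last by ring.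
by ring.
Qed.

Lemma edge_bound m f p d (B : R) :
  (forall t : R, 0 <= t <= 1 -> cmod (f (p + d * t%:C)) <= B) ->
  cmod (edge m f p d) <= cmod d * B.
Proof.
move=> fB; have B0 : 0 <= B.
  by apply: le_trans (cmod_ge0 _) (fB 0 _); rewrite lexx ler01.
rewrite /edge -mulrA cmodM ler_wpM2l ?cmod_ge0 //.
rewrite cmodM cmod_real ?invr_ge0 ?ler0n //.
(* For [m = 0] the inverse is [0] by convention; the second summand keeps the identity true. *)
have -> : B = m%:R^-1 * (m%:R * B) + (m == 0)%:R * B.
  case: m => [|m]; first by rewrite invr0 !mul0r mul1r add0r.
  by rewrite mul0r addr0 mulKf // pnatr_eq0.
apply: ler_wpDr; first by rewrite mulr_ge0.
rewrite ler_wpM2l ?invr_ge0 ?ler0n //.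
apply: le_trans (cmod_sum _ _) _.
rewrite mulr_natl -[X in _ <= _ *+ X]card_ord -sumr_const.
by apply: ler_sum => j _; apply: fB; exact: midpt_itv.
Qed.

Lemma contour_bound m f p d (B : R) :
  (forall z, in_square p d z -> cmod (f z) <= B) ->
  cmod (contour m f p d) <= 4 * cmod d * B.
Proof.
move=> fB.
have cid : cmod ('i%C * d) = cmod d by rewrite cmodM cmod_i mul1r.
have E (q e : R[i]) : cmod e = cmod d ->
    (forall t : R, 0 <= t <= 1 -> in_square p d (q + e * t%:C)) ->
    cmod (edge m f q e) <= cmod d * B.
  by move=> <- sq; apply: edge_bound => t t01; apply: fB; exact: sq.
have L1 : cmod (edge m f p d) <= cmod d * B.
  by apply: E => // t t01; exists t, 0; rewrite lexx ler01.
have L2 : cmod (edge m f (p + d) ('i%C * d)) <= cmod d * B.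
  apply: E => // t t01; exists 1, t; rewrite lexx ler01; split => //.
  by rewrite (complexE (1 +i* t)) /= rmorph1; ring.
have L3 : cmod (edge m f (p + 'i%C * d) d) <= cmod d * B.
  apply: E => // t t01; exists t, 1; rewrite lexx ler01; split => //.
  by rewrite (complexE (t +i* 1)) /= rmorph1; ring.
have L4 : cmod (edge m f p ('i%C * d)) <= cmod d * B.
  apply: E => // t t01; exists 0, t; rewrite lexx ler01; split => //.
  by rewrite (complexE (0 +i* t)) /= rmorph0; ring.
rewrite /contour.
have := cmodB (edge m f p d + edge m f (p + d) ('i%C * d) - edge m f (p + 'i%C * d) d)
  (edge m f p ('i%C * d)).
have := cmodB (edge m f p d + edge m f (p + d) ('i%C * d)) (edge m f (p + 'i%C * d) d).
have := cmodD (edge m f p d) (edge m f (p + d) ('i%C * d)).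
lra.
Qed.

Lemma sum_midpt m : (0 < m)%N -> \sum_(j < m) midpt m j = m%:R / 2.
Proof.
move=> m0; rewrite -mulr_suml.
have m0' : (m%:R : R) != 0 by rewrite pnatr_eq0 -lt0n.
apply: (mulIf m0'); rewrite mulfVK //.
elim: {m0 m0'} m => [|m IH]; first by rewrite big_ord0 !mul0r.
by rewrite big_ord_recr /= IH -[in RHS]natr1; field.
Qed.

(** The midpoint rule is exact on affine functions; hence their contour sums vanish for each
    positive [m], not merely in the limit. *)
Lemma edge_affine m (a b : R[i]) p d : (0 < m)%N ->
  edge m (fun z => a + b * z) p d = d * (a + b * p + b * d / 2).
Proof.
move=> m0; rewrite /edge -mulrA; congr (_ * _).
have m0' : (m%:R : R[i]) != 0 by rewrite pnatr_eq0 -lt0n.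
rewrite (eq_bigr (fun j : 'I_m => (a + b * p) + b * d * (midpt m j)%:C)); last first.
  by move=> j _; ring.
rewrite big_split /= sumr_const card_ord -mulr_sumr -rmorph_sum /= sum_midpt //.
by rewrite fmorph_div fmorphV !rmorph_nat /= -(mulr_natl (a + _)); field.
Qed.

Lemma contour_affine m (a b : R[i]) p d : (0 < m)%N ->
  contour m (fun z => a + b * z) p d = 0.
Proof.
by move=> m0; rewrite /contour !edge_affine //; field.
Qed.

Lemma edgeD m f g p d :
  edge m (fun z => f z + g z) p d = edge m f p d + edge m g p d.
Proof. by rewrite /edge big_split mulrDr. Qed.

Lemma edgeZ m c f p d : edge m (fun z => c * f z) p d = c * edge m f p d.
Proof. by rewrite /edge -mulr_sumr; ring. Qed.

Lemma contourD m f g p d :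
  contour m (fun z => f z + g z) p d = contour m f p d + contour m g p d.
Proof. by rewrite /contour !edgeD; ring. Qed.

End Contour.

(** * Goursat's theorem for midpoint sums on squares *)

Section Goursat.
Context {R : realType}.
Implicit Types (p d z w c : R[i]) (f g : R[i]^o -> R[i]^o) (m n : nat).

(** Left endpoints increase and right endpoints decrease, so the supremum of the left endpoints lies
    in every interval. *)
Lemma nested_dyadic (u : nat -> R) :
  (forall k, u k <= u k.+1 <= u k + (2^-1) ^+ k.+1) ->
  exists x, forall k, u k <= x <= u k + (2^-1) ^+ k.
Proof.
move=> uS.
have up j k : (j <= k)%N -> u j <= u k /\ u k + (2^-1) ^+ k <= u j + (2^-1) ^+ j.
  move=> /subnK <-; elim: (k - j)%N => [//|i [IH1 IH2]].
  rewrite addSn; have /andP[a b] := uS (i + j)%N.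
  move: b IH2; rewrite exprS; lra.
have ub j k : u j <= u k + (2^-1) ^+ k.
  have h i : (0 : R) <= (2^-1) ^+ i by rewrite exprn_ge0 // invr_ge0.
  have [/up[a b]|/ltnW/up[a b]] := leqP j k; have := h k; have := h j; lra.
have hs : has_sup (range u).
  by split; [exists (u 0%N), 0%N|exists (u 0%N + (2^-1) ^+ 0) => _ [j _ <-]].
exists (sup (range u)) => k; apply/andP; split.
  by apply: ub_le_sup; [case: hs|exists k].
by apply: ge_sup; [case: hs|move=> _ [j _ <-]].
Qed.

(** Here [bad k x y] concerns the square of side [2^-k] with lower left corner [(x, y)]. Repeatedly
    choosing a bad quarter gives nested squares with a common point. *)
Lemma nested_squares (bad : nat -> R -> R -> Prop) : bad 0%N 0 0 ->
  (forall k x y, bad k x y -> exists a b : bool,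
     bad k.+1 (x + a%:R * (2^-1) ^+ k.+1) (y + b%:R * (2^-1) ^+ k.+1)) ->
  exists x y, [/\ 0 <= x <= 1, 0 <= y <= 1 & forall k, exists x' y',
    [/\ bad k x' y', x' <= x <= x' + (2^-1) ^+ k & y' <= y <= y' + (2^-1) ^+ k]].
Proof.
move=> bad0 badS.
(* The implication makes the statement total, as [choice] requires; on squares that are not bad the
   quarter is arbitrary. *)
have step (s : nat * R * R) : exists ab : bool * bool, bad s.1.1 s.1.2 s.2 ->
    bad s.1.1.+1 (s.1.2 + ab.1%:R * (2^-1) ^+ s.1.1.+1)
      (s.2 + ab.2%:R * (2^-1) ^+ s.1.1.+1).
  have [/badS[a [b h]]|nb] := pselect (bad s.1.1 s.1.2 s.2).
    by exists (a, b).
  by exists (true, true) => /nb.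
have [F HF] := choice step.
pose u := fix u k : R * R := if k is j.+1 then
  ((u j).1 + (F (j, (u j).1, (u j).2)).1%:R * (2^-1) ^+ j.+1,
   (u j).2 + (F (j, (u j).1, (u j).2)).2%:R * (2^-1) ^+ j.+1) else (0, 0).
have badu k : bad k (u k).1 (u k).2.
  elim: k => [//|k IH]; exact: (HF (k, (u k).1, (u k).2)).
have bh (b : bool) k : 0 <= b%:R * (2^-1) ^+ k <= (2^-1 : R) ^+ k.
  have h : (0 : R) <= (2^-1) ^+ k by rewrite exprn_ge0 // invr_ge0.
  by case: b; rewrite /= ?mul1r ?mul0r lexx ?andbT ?h.
have [|x hx] := @nested_dyadic (fun k => (u k).1).
  by move=> k /=; rewrite lerDl lerD2l; exact: bh.
have [|y hy] := @nested_dyadic (fun k => (u k).2).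
  by move=> k /=; rewrite lerDl lerD2l; exact: bh.
exists x, y; split.
- by have := hx 0%N; rewrite expr0 /= add0r.
- by have := hy 0%N; rewrite expr0 /= add0r.
- by move=> k; exists (u k).1, (u k).2; split; [exact: badu|exact: hx|exact: hy].
Qed.

Lemma half_expC k : ((2^-1 : R) ^+ k)%:C = (2 ^+ k)^-1 :> R[i].
Proof. by rewrite rmorphXn /= fmorphV rmorph_nat exprVn. Qed.

Lemma expr_small (q e : R) : 0 <= q < 1 -> 0 < e ->
  \forall n \near \oo, q ^+ n < e.
Proof.
move=> /andP[q0 q1] e0; have : (@GRing.exp R q) @ \oo --> (0 : R).
  by apply: cvg_expr; rewrite ger0_norm.
move=> /cvgrPdist_lt /(_ _ e0); apply: filterS => n /=.
by rewrite sub0r normrN ger0_norm ?exprn_ge0.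
Qed.

Lemma half_expr_small (e : R) : 0 < e -> exists k, (2^-1) ^+ k < e.
Proof.
move=> e0; have [|k _ /(_ k (leqnn k))] := @expr_small 2^-1 e _ e0; first lra.
by exists k.
Qed.

Lemma contour_double4 n f p d (B : bool -> bool -> R) :
  (forall a b : bool, cmod (contour (2 ^ n) f (p + d * (a%:R / 2 +i* (b%:R / 2))) (d / 2)) <= B a b) ->
  cmod (contour (2 ^ n.+1) f p d) <=
    B false false + B true false + B false true + B true true.
Proof.
move=> H.
have := H false false; have := H true false; have := H false true; have := H true true.
have E (a b : bool) : a%:R / 2 +i* (b%:R / 2) = a%:R / 2 + 'i%C * (b%:R / 2) :> R[i].
  by rewrite (complexE (_ +i* _)) /= !rmorphM /= !fmorphV !rmorph_nat.
rewrite !{}E /= !mul0r !mulr0 !addr0 !add0r !mulr0 !addr0 !mul1r.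
rewrite expnS mul2n -addnn contour_double.
rewrite (_ : p + d * (2^-1 + 'i%C / 2) = p + d / 2 + 'i%C * (d / 2)); last by ring.
rewrite (_ : p + d * ('i%C / 2) = p + 'i%C * (d / 2)); last by ring.
set c1 := contour _ _ p _; set c2 := contour _ _ (p + _ / 2) _.
set c3 := contour _ _ (p + 'i%C * _) _; set c4 := contour _ _ _ _.
have := cmodD (c1 + c2 + c3) c4; have := cmodD (c1 + c2) c3; have := cmodD c1 c2.
lra.
Qed.

(** A square is bad when its sums are not eventually bounded by [e1] times its area. A bad square
    has a bad quarter, and the bad squares shrink to a point where the affine approximation of [f]
    contradicts badness. *)
Lemma goursat f p d : (forall z, in_square p d z -> derivable f z 1) ->
  forall e : R, 0 < e -> \forall n \near \oo, cmod (contour (2 ^ n) f p d) <= e.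
Proof.
move=> df e e0; pose e1 := e / (cmod d ^+ 2 + 1).
have d20 : 0 < cmod d ^+ 2 + 1 by have := sqr_ge0 (cmod d); lra.
have e10 : 0 < e1 by rewrite divr_gt0.
suff: \forall n \near \oo, cmod (contour (2 ^ n) f p d) <= e1 * cmod d ^+ 2.
  apply: filterS => n /le_trans; apply.
  rewrite /e1 mulrAC ler_pdivrMr // ler_pM2l //; lra.
apply: contrapT => bad0.
pose bad k x y := ~ \forall n \near \oo,
  cmod (contour (2 ^ n) f (p + d * (x +i* y)) (d / 2 ^+ k)) <=
    e1 * (cmod d * (2^-1) ^+ k) ^+ 2.
have [||x [y [x01 y01 xy]]] := @nested_squares bad.
- by rewrite /bad !expr0 divr1 mulr1 mulr0 addr0.
- move=> k x y; rewrite /bad => badk; apply: contrapT => nb; apply: badk.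
  have good (a b : bool) : \forall n \near \oo,
      cmod (contour (2 ^ n) f (p + d * (x +i* y) + d / 2 ^+ k * (a%:R / 2 +i* (b%:R / 2)))
        (d / 2 ^+ k / 2)) <= e1 * (cmod d * (2^-1) ^+ k.+1) ^+ 2.
    apply: contrapT => nab; apply: nb; exists a, b => H; apply: nab.
    move: H; rewrite (_ : d / 2 ^+ k.+1 = d / 2 ^+ k / 2); last first.
      by rewrite exprS invfM; ring.
    rewrite (_ : p + _ = p + d * (x +i* y) + d / 2 ^+ k * (a%:R / 2 +i* (b%:R / 2))) //.
    rewrite -(half_expC k) -addrA -mulrA -mulrDr; congr (_ + _ * _).
    by simpc; rewrite exprS; congr (_ +i* _); ring.
  have gS : \forall n \near \oo, cmod (contour (2 ^ n.+1) f (p + d * (x +i* y)) (d / 2 ^+ k))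
      <= e1 * (cmod d * (2^-1) ^+ k) ^+ 2.
    near=> n; rewrite (_ : e1 * _ = let B := e1 * (cmod d * (2^-1) ^+ k.+1) ^+ 2 in
      B + B + B + B); last by rewrite (exprS _ k) /=; field.
    by apply: (contour_double4 (B := fun _ _ => _)) => -[] []; near: n; apply: good.
  (* Sums of order [n] on the quarters control order [n.+1] on the square, so the threshold moves by
     one. *)
  have [N _ HN] := gS; exists N.+1 => // -[//|n] /= /HN; exact.
have zsq : in_square p d (p + d * (x +i* y)) by exists x, y.
have /derivable_cmodP[D] := df _ zsq.
(* The factor [1 / 8] compensates for a perimeter of four sides and for distances to the limit point
   of at most two sides. *)
move=> /(_ (e1 / 8) (divr_gt0 e10 (ltr0Sn _ _)))[r r0 fr].
have [k hk] : exists k, (2^-1) ^+ k < r / (2 * cmod d + 1).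
  by apply: half_expr_small; rewrite divr_gt0 //; have := cmod_ge0 d; lra.
have dk : 2 * (cmod d * (2^-1) ^+ k) < r.
  move: hk; rewrite ltr_pdivlMr; last by have := cmod_ge0 d; lra.
  have : (0 : R) < (2^-1) ^+ k by rewrite exprn_gt0 // invr_gt0.
  by lra.
have [x' [y' [badk xx yy]]] := xy k; apply: badk; near=> n.
set z := p + d * (x +i* y) in zsq fr *; set p' := p + _.
(* [A] is the affine approximation at [z]. Its contour sums are zero, so [f] may be replaced by the
   remainder [f - A]. *)
pose A w := (f z - D * z) + D * w.
have cdk : cmod (d / 2 ^+ k) = cmod d * (2^-1) ^+ k.
  by rewrite -half_expC cmodM cmod_real // exprn_ge0 // invr_ge0.
have -> : contour (2 ^ n) f p' (d / 2 ^+ k) =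
    contour (2 ^ n) (fun w => f w + (- A w)) p' (d / 2 ^+ k).
  rewrite contourD.
  rewrite (_ : (fun w => - A w) = (fun w => (- (f z - D * z)) + (- D) * w)).
    by rewrite contour_affine ?expn_gt0 // addr0.
  by apply/funext => w; rewrite /A; ring.
rewrite (_ : e1 * _ = 4 * (cmod d * (2^-1) ^+ k) * (e1 / 8 * (2 * (cmod d * (2^-1) ^+ k)))).
  rewrite -cdk; apply: contour_bound => w [s [t [s01 t01 wE]]].
  have wz : cmod (w - z) <= 2 * cmod (d / 2 ^+ k).
    rewrite wE /p' /z -half_expC.
    rewrite (_ : _ - _ = d * ((x' - x + (2^-1) ^+ k * s) +i* (y' - y + (2^-1) ^+ k * t))).
      rewrite !cmodM cmod_real ?exprn_ge0 ?invr_ge0 // mulrCA ler_wpM2l ?cmod_ge0 //.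
      apply: le_trans (cmod_le_ReIm _) _; rewrite /= mulr_natl mulr2n.
      have h0 : (0 : R) <= (2^-1) ^+ k by rewrite exprn_ge0 // invr_ge0.
      by apply: lerD; rewrite ler_norml; nra.
    rewrite -mulrA (_ : _ - _ = d * (x' +i* y' + ((2^-1) ^+ k)%:C * (s +i* t) - x +i* y)).
      by congr (_ * _); simpc; congr (_ +i* _); ring.
    by ring.
  have := fr w; rewrite /A -cdk in dk *.
  rewrite (_ : f w - _ - _ = f w + - (f z - D * z + D * w)); last by ring.
  move=> /(_ (le_lt_trans wz dk)) /le_trans; apply.
  by rewrite ler_wpM2l // divr_ge0 // ltW.
by field.
Unshelve. all: by end_near. Qed.

Lemma in_square_child (a b : bool) p d z :
  in_square (p + d * (a%:R / 2 +i* (b%:R / 2))) (d / 2) z ->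
  in_square p d z /\ (a || b -> d != 0 -> z != p).
Proof.
move=> [x [y [x01 y01 ->]]].
have E : p + d * (a%:R / 2 +i* (b%:R / 2)) + d / 2 * (x +i* y) =
    p + d * ((a%:R + x) / 2 +i* ((b%:R + y) / 2)).
  have -> : (2 : R[i]) ^-1 = (2^-1 : R)%:C by rewrite fmorphV rmorph_nat.
  by rewrite -addrA -mulrA -mulrDr; congr (_ + _ * _); simpc; congr (_ +i* _); ring.
rewrite {}E; split.
  exists ((a%:R + x) / 2), ((b%:R + y) / 2); split => //.
    by case: a => /=; lra.
  by case: b => /=; lra.
move=> ab d0; rewrite -subr_eq0 addrAC subrr add0r mulf_eq0 (negbTE d0) /=.
rewrite eq_complex /=; apply/negP => /andP[/eqP a0 /eqP b0].
by case: a b ab a0 b0 => [] [] //= _; lra.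
Qed.

(** Three of the quarters avoid the corner [p] and fall under [goursat]. After [k] subdivisions only
    a square of side [cmod d * 2^-k] at [p] remains, and there the bound [B] suffices. This is
    designed for difference quotients. *)
Lemma goursat_corner f p d (B : R) :
  (forall z, in_square p d z -> z != p -> derivable f z 1) ->
  (forall z, in_square p d z -> cmod (f z) <= B) ->
  forall e : R, 0 < e -> \forall n \near \oo, cmod (contour (2 ^ n) f p d) <= e.
Proof.
move=> df fB e e0; have psq : in_square p d p.
  by exists 0, 0; rewrite lexx ler01 mulr0 addr0.
have B0 : 0 <= B := le_trans (cmod_ge0 _) (fB p psq).
have [k hk] : exists k, (2^-1) ^+ k < e / 2 / (4 * cmod d * B + 1).
  have cB : 0 <= cmod d * B by rewrite mulr_ge0 // cmod_ge0.
  by apply: half_expr_small; rewrite !divr_gt0 //; lra.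
suff {hk}: forall d, (forall z, in_square p d z -> z != p -> derivable f z 1) ->
    (forall z, in_square p d z -> cmod (f z) <= B) -> forall e : R, 0 < e ->
    \forall n \near \oo,
      cmod (contour (2 ^ n) f p d) <= 4 * cmod d * B * (2^-1) ^+ k + e.
  move=> /(_ d df fB (e / 2) (divr_gt0 e0 (ltr0Sn _ _))).
  apply: filterS => n /le_trans; apply; move: hk.
  have cB : 0 <= cmod d * B by rewrite mulr_ge0 // cmod_ge0.
  rewrite ltr_pdivlMr; last lra.
  have : (0 : R) < (2^-1) ^+ k by rewrite exprn_gt0 // invr_gt0.
  by lra.
move=> {e e0 df fB psq d}; elim: k => [|k IH] d df fB e e0.
  apply: nearW => n; rewrite expr0 mulr1.
  by apply: le_trans (contour_bound _ fB) _; lra.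
have [d0|d0] := eqVneq d 0.
  apply: nearW => n; apply: le_trans (contour_bound _ fB) _.
  by rewrite d0 cmod0; lra.
have e40 : 0 < e / 4 by rewrite divr_gt0.
have child (a b : bool) : a || b -> \forall n \near \oo, cmod (contour (2 ^ n) f
    (p + d * (a%:R / 2 +i* (b%:R / 2))) (d / 2)) <= e / 4.
  move=> ab; apply: goursat => // z /in_square_child[zs zp].
  by apply: df => //; exact: zp.
have child0 : \forall n \near \oo, cmod (contour (2 ^ n) f
    (p + d * (false%:R / 2 +i* (false%:R / 2))) (d / 2)) <=
    4 * cmod (d / 2) * B * (2^-1) ^+ k + e / 4.
  have sub z : in_square p (d / 2) z -> in_square p d z.
    move=> zs; apply: (proj1 (@in_square_child false false _ _ _ _)).
    by rewrite /= !mul0r mulr0 addr0.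
  rewrite /= !mul0r mulr0 addr0; apply: IH => // z /sub.
    exact: df.
  exact: fB.
have gS : \forall n \near \oo, cmod (contour (2 ^ n.+1) f p d) <=
    4 * cmod d * B * (2^-1) ^+ k.+1 + e.
  pose C (a b : bool) := if a || b then e / 4 else
    4 * cmod (d / 2) * B * (2^-1) ^+ k + e / 4.
  near=> n; rewrite (_ : _ + e = C false false + C true false + C false true + C true true).
    by apply: contour_double4 => -[] []; near: n; rewrite /C /=;
      [exact: (child true true)|exact: (child true false)
      |exact: (child false true)|exact: child0].
  by rewrite /C /= cmodM cmodV cmod2 exprS; field.
have [N _ HN] := gS; exists N.+1 => // -[//|n] /= /HN; exact.
Unshelve. all: by end_near. Qed.
End Goursat.

(** * A weak Cauchy estimate at the centre of a disc *)

Section LocalBound.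
Context {R : realType}.
Implicit Types (p d z w c : R[i]) (f g : R[i]^o -> R[i]^o) (m n : nat).

Lemma closed_bounded_compact_cmod (A : set R[i]^o) (B : R) : closed A ->
  (forall z, A z -> cmod z <= B) -> compact A.
Proof.
move=> cA AB.
pose h (xy : R * R) : R[i]^o := xy.1 +i* xy.2.
have cI : compact (`[- B, B]%classic : set R) by exact: segment_compact.
have /(continuous_compact _) : compact ((`[- B, B]%classic : set R) `*` (`[- B, B]%classic : set R)).
  exact: compact_setX.
move=> /(_ _ h) ch; apply: subclosed_compact cA (ch _) _.
  apply: continuous_subspaceT => -[x y] V /nbhs_cmodP[r r0 rV].
  have r20 : 0 < r / 2 by rewrite divr_gt0.
  exists (ball x (r / 2), ball y (r / 2)); first by split; exact: nbhsx_ballx.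
  move=> -[x' y'] [/= xx yy]; apply: rV; rewrite /h.
  apply: le_lt_trans (cmod_le_ReIm _) _; rewrite /=.
  move: xx yy; rewrite /ball /= => xx yy.
  by rewrite (distrC x') (distrC y'); lra.
move=> z /AB zB; exists (Re z, Im z); last by rewrite /h; case: z {zB}.
by split=> /=; rewrite in_itv /= -ler_norml;
  [apply: le_trans (Re_le_cmod _) zB|apply: le_trans (Im_le_cmod _) zB].
Qed.

Lemma compact_annulus z (a b : R) :
  compact [set w : R[i]^o | a <= cmod (w - z) <= b].
Proof.
apply: (@closed_bounded_compact_cmod _ (b + cmod z)).
  apply/closed_cmodP => w nw.
  have tri u : cmod (u - z) <= cmod (u - w) + cmod (w - z) /\
      cmod (w - z) <= cmod (u - w) + cmod (u - z).
    by rewrite cmod_tri; split => //; rewrite (cmodC u w) cmod_tri.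
  have [wa|aw] := ltP (cmod (w - z)) a.
    exists (a - cmod (w - z)); first by rewrite subr_gt0.
    by move=> u uw /= /andP[+ _]; have [+ _] := tri u; lra.
  exists (cmod (w - z) - b).
    by rewrite subr_gt0 ltNge; apply/negP => wb; apply: nw; rewrite /= aw wb.
  by move=> u uw /= /andP[_]; have [_ +] := tri u; lra.
move=> w /= /andP[_]; have := cmodD (w - z) z; rewrite subrK; lra.
Qed.

(** The two sides, with orientation, that do not contain the corner [z]. For the four directions
    [i^k d] they make up the boundary of the square centred at [z]. *)
Definition outer m f z d : R[i] :=
  edge m f (z + d) ('i%C * d) - edge m f (z + 'i%C * d) d.

Lemma mulii : 'i%C * 'i%C = -1 :> R[i]. Proof. by rewrite -expr2 sqr_i. Qed.

(* The four squares with corner [z] and sides [i^k d] share their inner edges,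
   which cancel. *)
Lemma contour_quadrants m f z d :
  contour m f z d + contour m f z ('i%C * d) + contour m f z (- d)
    + contour m f z (- ('i%C * d)) =
  outer m f z d + outer m f z ('i%C * d) + outer m f z (- d)
    + outer m f z (- ('i%C * d)).
Proof.
by rewrite /contour /outer !mulrN !mulrA !mulii !mulN1r !opprK; ring.
Qed.

(** A discrete substitute for the winding number. Pairing the nodes of the two sides with equal
    parameter [t] gives ['i * 2 / (1 + t^2)], and [2 / (1 + t^2)] is at least [1] on the unit
    interval. *)
Lemma outer_kernel m z d : (0 < m)%N -> d != 0 ->
  1 <= Im (outer m (fun u => (u - z)^-1) z d).
Proof.
move=> m0 d0.
have m0' : (0 : R) < m%:R by rewrite ltr0n.
have E (t : R) : 'i%C * d * (z + d + 'i%C * d * t%:C - z)^-1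
    - d * (z + 'i%C * d + d * t%:C - z)^-1 = 'i%C * (2 / (1 + t ^+ 2))%:C.
  have t0 : 1 + t ^+ 2 != 0 by rewrite lt0r_neq0 //; have := sqr_ge0 t; lra.
  have n1 : 1 +i* t != 0.
    by rewrite eq_complex /= oner_eq0.
  have n2 : t +i* 1 != 0.
    by rewrite eq_complex /= oner_eq0 andbF.
  have tE : t%:C ^+ 2 + 1 != 0 :> R[i].
    by rewrite -rmorphXn -(rmorph1 (real_complex R)) -rmorphD /= addrC; apply: contra t0 => /eqP/complexI ->.
  rewrite (_ : z + d + _ - z = d * (1 +i* t)); last first.
    by rewrite (complexE (1 +i* t)) /= rmorph1; ring.
  rewrite (_ : z + _ + _ - z = d * (t +i* 1)); last first.
    by rewrite (complexE (t +i* 1)) /= rmorph1; ring.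
  rewrite !invfM !mulrA (mulfK d0) mulfV // mul1r.
  have -> : (1 +i* t)^-1 = (1 -i* t) * ((1 + t ^+ 2)^-1)%:C :> R[i].
    apply: (mulIf n1); rewrite mulVf // mulrAC; simpc.
    by congr (_ +i* _); field.
  have -> : (t +i* 1)^-1 = (t -i* 1) * ((1 + t ^+ 2)^-1)%:C :> R[i].
    apply: (mulIf n2); rewrite mulVf // mulrAC; simpc.
    by congr (_ +i* _); field.
  by simpc; congr (_ +i* _); field.
rewrite /outer /edge -!(mulrAC _ _ (m%:R^-1)%:C) -mulrBl !mulr_sumr -sumrB.
rewrite (eq_bigr _ (fun (j : 'I_m) _ => E (midpt m j))) -mulr_sumr -rmorph_sum /=.
simpc => /=; rewrite -ler_pdivrMr ?invr_gt0 // invrK mul1r.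
rewrite -[X in X%:R <= _]card_ord -sumr_const; apply: ler_sum => j _.
have /andP[t0 t1] := @midpt_itv R m j.
by rewrite ler_pdivlMr; nra.
Qed.

Lemma outer_bound m f z d (B : R) :
  (forall w, cmod d <= cmod (w - z) <= 2 * cmod d -> cmod (f w) <= B) ->
  cmod (outer m f z d) <= 2 * cmod d * B.
Proof.
move=> fB; rewrite /outer.
have cid : cmod ('i%C * d) = cmod d by rewrite cmodM cmod_i mul1r.
have b1 (x y : R) : 0 <= x <= 1 -> 0 <= y <= 1 -> x = 1 \/ y = 1 ->
    cmod d <= cmod (d * (x +i* y)) <= 2 * cmod d.
  move=> x01 y01 xy1; rewrite cmodM; apply/andP; split.
    apply: ler_peMr; first exact: cmod_ge0.
    have := Re_le_cmod (x +i* y); have := Im_le_cmod (x +i* y).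
    by move=> /(le_trans (ler_norm _)) /= + /(le_trans (ler_norm _)) /=; lra.
  rewrite mulrC ler_wpM2r ?cmod_ge0 //; apply: le_trans (cmod_le_ReIm _) _.
  by rewrite /= !ger0_norm; lra.
have L1 : cmod (edge m f (z + d) ('i%C * d)) <= cmod d * B.
  rewrite -cid; apply: edge_bound => t t01; apply: fB.
  rewrite (_ : _ - z = d * (1 +i* t)); first by apply: b1 => //; [lra|left].
  by rewrite (complexE (1 +i* t)) /= rmorph1; ring.
have L2 : cmod (edge m f (z + 'i%C * d) d) <= cmod d * B.
  apply: edge_bound => t t01; apply: fB.
  rewrite (_ : _ - z = d * (t +i* 1)); first by apply: b1 => //; [lra|right].
  by rewrite (complexE (t +i* 1)) /= rmorph1; ring.
by apply: le_trans (cmodB _ _) _; lra.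
Qed.

(** Differentiability bounds the quotient near [z], compactness bounds it on the remaining annulus.
    At [z] itself its value is [0] by convention. *)
Lemma cmod_quotient_bounded f z (r : R) : 0 < r ->
  (forall w, cmod (w - z) <= r -> derivable f w 1) ->
  exists B, forall w, cmod (w - z) <= r -> cmod ((f w - f z) / (w - z)) <= B.
Proof.
move=> r0 df; have /derivable_cmodP[D /(_ 1 ltr01)[s s0 fs]] : derivable f z 1.
  by apply: df; rewrite subrr cmod0 ltW.
pose A : set R[i]^o := [set w | s <= cmod (w - z) <= r].
have [B0 B0P] : exists B, forall w, A w -> cmod ((f w - f z) / (w - z)) <= B.
  have [A0|/set0P A0] := eqVneq A set0; first by exists 0; rewrite A0.
  suff qA : alg_A A (fun w => (f w - f z) / (w - z)).
    have [c _ cmax] := alg_A_cmod_max A0 (@compact_annulus z s r) qA.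
    by exists (cmod ((f c - f z) / (c - z))).
  apply: alg_A_mul.
    apply: alg_A_sub (alg_A_cst _ _).
    by apply: alg_A_derivable => w /= /andP[_]; exact: df.
  apply: alg_A_inv; first exact: alg_A_sub (alg_A_id _) (alg_A_cst _ _).
  by move=> w /= /andP[ws _]; rewrite -cmod_gt0; lra.
exists (Num.max B0 (1 + cmod D)) => w wr; rewrite le_max.
have [ws|sw] := ltP (cmod (w - z)) s; last first.
  by rewrite B0P // /A /= sw.
have [->|wz] := eqVneq w z.
  by rewrite !subrr mul0r cmod0; apply/orP; right; have := cmod_ge0 D; lra.
apply/orP; right; rewrite cmodM cmodV ler_pdivrMr; last by rewrite cmod_gt0 subr_eq0.
have := fs w ws; have := cmod_lb (f w - f z) (- (D * (w - z))).
by rewrite cmodN cmodM; lra.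
Qed.

(* A weak Cauchy estimate: the constant [2] is irrelevant, since the estimate
   will be applied to powers of a function. *)
Lemma cmod_center_le f z (r C : R) : 0 < r ->
  (forall w, cmod (w - z) <= 2 * r -> derivable f w 1) ->
  (forall w, r <= cmod (w - z) <= 2 * r -> cmod (f w) <= C) ->
  cmod (f z) <= 2 * C.
Proof.
move=> r0 df fC; apply/ler_addgt0Pr => e e0.
have [|B GB] := cmod_quotient_bounded _ df; first lra.
pose G w := (f w - f z) / (w - z); rewrite -/G in GB.
(* The quotient [G] is differentiable away from [z], which is the common corner of the four
   squares. *)
have near_quad d : cmod d = r -> \forall n \near \oo, cmod (contour (2 ^ n) G z d) <= e.
  move=> dr.
  have sq w : in_square z d w -> cmod (w - z) <= 2 * r.
    move=> [x [y [x01 y01 ->]]]; rewrite addrAC subrr add0r cmodM dr mulrC.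
    apply: ler_wpM2r; first exact: ltW.
    apply: le_trans (cmod_le_ReIm _) _.
    by rewrite /= !ger0_norm; lra.
  apply: (@goursat_corner _ _ _ _ B) e e0 => [w /sq wr wz|w /sq]; last exact: GB.
  apply: derivableM; first by apply: derivableB; [exact: df|exact: derivable_cst].
  apply: derivableV; first by rewrite subr_eq0.
  by apply: derivableB; [exact: derivable_id|exact: derivable_cst].
have rC : cmod (r%:C : R[i]) = r by rewrite cmod_real // ltW.
have irC : cmod ('i%C * r%:C : R[i]) = r by rewrite cmodM cmod_i mul1r.
have [N _ HN] := filterI (filterI (near_quad _ rC) (near_quad _ irC))
  (filterI (near_quad (- r%:C) (etrans (cmodN _) rC))
     (near_quad (- ('i%C * r%:C)) (etrans (cmodN _) irC))).
have [[/= c1 c2] [/= c3 c4]] := HN N (leqnn N).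
set m := (2 ^ N)%N in c1 c2 c3 c4; have m0 : (0 < m)%N by rewrite expn_gt0.
pose k w : R[i] := (w - z)^-1.
(* This is the splitting behind Cauchy's formula: the outer sums of [G] add up to contour sums,
   which are small, and those of [k] are bounded below. *)
have fk d : outer m (fun w => f w * k w) z d = f z * outer m k z d + outer m G z d.
  have -> : (fun w => f w * k w) = (fun w => f z * k w + G w).
    by apply/funext => w; rewrite /G /k; ring.
  by rewrite /outer !edgeD !edgeZ; ring.
have fkB d : cmod d = r -> cmod (outer m (fun w => f w * k w) z d) <= 2 * C.
  move=> dr; have -> : 2 * C = 2 * cmod d * (C / r) by rewrite dr; field; lra.
  apply: outer_bound => w; rewrite dr => wr; rewrite cmodM cmodV.
  have w0 : 0 < cmod (w - z) by lra.
  have C0 : 0 <= C := le_trans (cmod_ge0 _) (fC w wr).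
  apply: ler_pM; rewrite ?invr_ge0 ?cmod_ge0 ?fC //.
  by rewrite lef_pV2 //; lra.
have r0C : r%:C != 0 :> R[i] by rewrite -cmod_gt0 rC.
have i0C : 'i%C * r%:C != 0 :> R[i] by rewrite -cmod_gt0 irC.
have k4 : 4 <= cmod (outer m k z r%:C + outer m k z ('i%C * r%:C)
    + outer m k z (- r%:C) + outer m k z (- ('i%C * r%:C))).
  apply: le_trans (Im_le_cmod _); apply: le_trans (ler_norm _).
  have := outer_kernel z m0 r0C; have := outer_kernel z m0 i0C.
  rewrite -oppr_eq0 in r0C; rewrite -oppr_eq0 in i0C.
  have := outer_kernel z m0 r0C; have := outer_kernel z m0 i0C.
  by rewrite !raddfD /= -/k; lra.
(* The four outer sums of [f * k] contribute at most [2 * C] each, and the four contour sums of [G]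
   at most [e] each. *)
have : cmod (f z) * 4 <= 8 * C + 4 * e.
  apply: le_trans (ler_wpM2l (cmod_ge0 _) k4) _; rewrite -cmodM.
  have := contour_quadrants m G z r%:C.
  set o1 := outer m G _ _; set o2 := outer m G _ _.
  set o3 := outer m G _ _; set o4 := outer m G _ _ => oE.
  have := fkB _ rC; have := fkB _ irC; have := fkB _ (etrans (cmodN _) rC).
  have := fkB _ (etrans (cmodN _) irC); rewrite !fk -/o1 -/o2 -/o3 -/o4.
  set a1 := f z * outer m k z r%:C; set a2 := f z * outer m k z ('i%C * r%:C).
  set a3 := f z * outer m k z (- r%:C); set a4 := f z * outer m k z (- ('i%C * r%:C)).
  move=> h4 h3 h2 h1; rewrite 3!mulrDr -/a1 -/a2 -/a3 -/a4.
  rewrite (_ : a1 + a2 + a3 + a4 = (a1 + o1 + (a2 + o2)) + ((a3 + o3) + (a4 + o4)) -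
    (contour m G z r%:C + contour m G z ('i%C * r%:C) + (contour m G z (- r%:C)
    + contour m G z (- ('i%C * r%:C))))); last by
    rewrite (addrA (contour m G z r%:C + _)) oE; ring.
  have T4 (x1 x2 x3 x4 : R[i]) : cmod (x1 + x2 + (x3 + x4)) <=
      cmod x1 + cmod x2 + cmod x3 + cmod x4.
    by have := cmodD (x1 + x2) (x3 + x4); have := cmodD x1 x2;
      have := cmodD x3 x4; lra.
  apply: le_trans (cmodB _ _) _; apply: le_trans (lerD (T4 _ _ _ _) (T4 _ _ _ _)) _.
  by lra.
lra.
Qed.
End LocalBound.

(** * The maximum modulus principle *)

Section MaximumModulus.
Context {R : realType}.
Implicit Types (p d z w c : R[i]) (K : set R[i]^o) (f g : R[i]^o -> R[i]^o).

(** Strict convexity of the unit disc. *)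
Lemma half_sum_lt1 (u : R[i]) : cmod u <= 1 -> u != 1 -> cmod ((1 + u) / 2) < 1.
Proof.
move=> u1 un1.
have Re1 : Re u < 1.
  have Rle : Re u <= 1.
    by apply: le_trans u1; apply: le_trans (Re_le_cmod _); exact: ler_norm.
  rewrite lt_neqAle Rle andbT; apply/eqP => Ru; move/eqP : un1; apply.
  have : cmod u ^+ 2 <= 1 by rewrite expr_le1 // cmod_ge0.
  rewrite cmod_sq Ru expr1n => Im0.
  have /eqP : Im u ^+ 2 = 0 by have := sqr_ge0 (Im u); lra.
  by rewrite sqrf_eq0 => /eqP Iu; apply/eqP; rewrite eq_complex Ru Iu /= !eqxx.
rewrite cmodM cmodV cmod2 ltr_pdivrMr // mul1r.
rewrite -(ltr_pXn2r (n := 2)) ?nnegrE ?cmod_ge0 //.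
have : cmod u ^+ 2 <= 1 by rewrite expr_le1 // cmod_ge0.
by rewrite !cmod_sq !raddfD /=; lra.
Qed.

Lemma cmod_subr_lt z w (e : R) : cmod (w - z) < e -> cmod w < cmod z + e.
Proof. by have := cmodD (w - z) z; rewrite subrK; lra. Qed.

Lemma derivable_nbhs_lt f z (b : R) : derivable f z 1 -> cmod (f z) < b ->
  \forall w \near (z : R[i]^o), cmod (f w) < b.
Proof.
move=> df fb; have [|r r0 fr] := derivable_continuous_cmod df (e := b - cmod (f z)).
  by rewrite subr_gt0.
apply/nbhs_cmodP; exists r => // w /fr /cmod_subr_lt; lra.
Qed.

(** If no maximum point is on the frontier, the compact set [M] of maximum points is interior. Let
    [z] in [M] be farthest from a point [b] outside [K]. The affine function [h] equals [1] at [z]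
    and has modulus below [1] on the rest of [M]. Then [H = f1 ^+ n * h] has modulus [1] at [z] but
    is below [1] on an annulus around [z], so a high power of [H] violates [cmod_center_le]. *)
Lemma frontier_maximum K f : K !=set0 -> compact K -> alg_A K f ->
  exists z, [/\ K z, frontier K z & forall w, K w -> cmod (f w) <= cmod (f z)].
Proof.
suff main g : K !=set0 -> compact K -> alg_A K g ->
    (exists2 c, K c & g c != 0) ->
    exists z, [/\ K z, frontier K z & forall w, K w -> cmod (g w) <= cmod (g z)].
  (* If [f] vanishes on [K], any frontier point will do, and the constant [1] provides one. *)
  move=> K0 cK Kf; have [f0|f0] := pselect (exists2 c, K c & f c != 0).
    exact: main.
  have [c Kc] := K0; have [|z [Kz fz _]] := main (fun=> 1) K0 cK (alg_A_cst _ _).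
    by exists c => //; rewrite oner_eq0.
  exists z; split => // w Kw; rewrite (_ : f w = 0) ?cmod0 ?cmod_ge0 //.
  by apply/eqP; apply/negPn/negP => fw; apply: f0; exists w.
move=> {f} K0 cK Kf [a Ka fa0]; apply: contrapT => nofr.
pose f := g; rewrite -/f in Kf fa0 nofr.
have [c Kc cmax] := alg_A_cmod_max K0 cK Kf.
have fc0 : 0 < cmod (f c).
  by apply: lt_le_trans (cmax a Ka); rewrite cmod_gt0.
have clK := compact_closed_cmod cK.
pose M : set R[i]^o := [set z | K z /\ cmod (f z) = cmod (f c)].
have Mint z : M z -> K° z.
  move=> [Kz fz]; apply: contrapT => nz; apply: nofr; exists z; split => //.
    by split => //; exact: subset_closure.
  by move=> w /cmax; rewrite fz.
have [B B0 KB] := compact_cmod_bounded cK.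
have cM : compact M.
  apply: (@closed_bounded_compact_cmod _ _ B); last first.
    by move=> z [/KB/ltW].
  apply/closed_cmodP => z nMz.
  have [Kz|nKz] := pselect (K z); last first.
    move/closed_cmodP : clK => /(_ _ nKz)[r r0 rK]; exists r => // w /rK nKw.
    by move=> [].
  have fzc : cmod (f z) < cmod (f c).
    by rewrite lt_neqAle cmax // andbT; apply/eqP => fz; exact: nMz.
  have [/within_continuousP cf _] := Kf.
  have [|r r0 rK] := cf z Kz (cmod (f c) - cmod (f z)); first by rewrite subr_gt0.
  by exists r => // w wz [Kw fw]; have := cmod_subr_lt (rK w Kw wz); rewrite fw; lra.
pose b : R[i] := B%:C.
have nKb : ~ K b.
  by move=> /KB; rewrite cmod_real ?ltxx // ltW.
have [||z [Kz fz] zmax] := @compact_cmod_max _ M (fun w => cmod (w - b)) _ cM.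
- by exists c.
- move=> w _ e e0; exists e => // u _ uw; rewrite ltr_norml.
  have : cmod (u - w) < e by [].
  have := cmod_tri u w b; have := cmod_tri w u b; rewrite (cmodC w u).
  by move=> ? ? ?; apply/andP; split; lra.
have zb0 : 0 < cmod (z - b).
  by rewrite cmod_gt0 subr_eq0; apply/eqP => zb; rewrite -zb in nKb.
have /interior_cmodP[r4 r40 rK] : K° z by apply: Mint.
pose r := r4 / 4; have r0 : 0 < r by rewrite divr_gt0.
have discK w : cmod (w - z) <= 2 * r -> K° w.
  move=> wz; apply/interior_cmodP; exists r => // u uw; apply: rK.
  by have := cmod_tri u w z; move: wz uw; rewrite /r; lra.
pose f1 w := f w / f z.
pose h w : R[i] := (1 + (w - b) / (z - b)) / 2.
have fz0 : 0 < cmod (f z) by rewrite fz.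
have Kf1 : alg_A K f1 by apply: alg_A_mul Kf (alg_A_cst _ _).
have Kh : alg_A K h.
  apply: alg_A_mul (alg_A_cst _ _); apply: alg_A_add (alg_A_cst _ _) _.
  apply: alg_A_mul (alg_A_cst _ _).
  exact: alg_A_sub (alg_A_id _) (alg_A_cst _ _).
have f1le w : K w -> cmod (f1 w) <= 1.
  by move=> /cmax; rewrite -fz => fw; rewrite cmodM cmodV ler_pdivrMr // mul1r.
pose A : set R[i]^o := [set w | r <= cmod (w - z) <= 2 * r].
have AK w : A w -> K° w by move=> /andP[_ /discK].
have cA : compact A := @compact_annulus _ _ _ _.
(* Where [cmod (f1 w) < 1] a large power beats [h]; where it equals [1] the point lies in [M] and
   [cmod (h w) < 1]. Compactness of the annulus makes [n] uniform. *)
have /filter_ex[n nA] : \forall n \near \oo, A `<=` [set w | cmod (f1 w ^+ n * h w) < 1].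
  move/compact_near_coveringP : (cA); apply => w Aw.
  have Kw := AK w Aw; have Kw' := interior_subset Kw.
  have nK : \forall u \near (w : R[i]^o), K u by exact: Kw.
  have [fw1|fw1] := ltP (cmod (f1 w)) 1.
    pose q := (1 + cmod (f1 w)) / 2.
    have q01 : 0 <= q < 1 by rewrite /q; have := cmod_ge0 (f1 w); lra.
    have [q0 _] := andP q01.
    have fq : \forall u \near (w : R[i]^o), cmod (f1 u) < q.
      by apply: derivable_nbhs_lt; [exact: (proj2 Kf1)|rewrite /q; lra].
    pose G := cmod (h w) + 1; have G0 : 0 < G by have := cmod_ge0 (h w); rewrite /G; lra.
    have hG : \forall u \near (w : R[i]^o), cmod (h u) < G.
      by apply: derivable_nbhs_lt; [exact: (proj2 Kh)|rewrite /G; lra].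
    have qn : \forall n \near \oo, q ^+ n < G^-1 by apply: expr_small; rewrite ?invr_gt0.
    exists ([set u | cmod (f1 u) < q /\ cmod (h u) < G], [set n | q ^+ n < G^-1]).
      by split => //; exact: filterI.
    move=> [u n] [/= [fu hu] qnG]; rewrite cmodM cmodX.
    have : cmod (f1 u) ^+ n <= q ^+ n.
      by rewrite lerXn2r ?nnegrE ?cmod_ge0 ?q0 // ltW.
    move=> fqn; apply: le_lt_trans (ler_wpM2r (cmod_ge0 _) fqn) _.
    have qn0 : 0 <= q ^+ n by rewrite exprn_ge0.
    apply: le_lt_trans (ler_wpM2l qn0 (ltW hu)) _.
    by rewrite -ltr_pdivlMr // div1r.
  have hw1 : cmod (h w) < 1.
    apply: half_sum_lt1.
      rewrite cmodM cmodV ler_pdivrMr // mul1r; apply: zmax; split => //.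
      apply/eqP; rewrite eq_le cmax // -fz.
      by move: fw1; rewrite cmodM cmodV ler_pdivlMr // mul1r.
    rewrite -(inj_eq (mulIf (_ : z - b != 0))) -?cmod_gt0 // mul1r divfK -?cmod_gt0 //.
    rewrite (inj_eq (addIr _)) -subr_eq0 -cmod_gt0.
    by case/andP: Aw => rw _; exact: lt_le_trans rw.
  exists ([set u | K u /\ cmod (h u) < 1], setT).
    split => /=; last exact: filterT.
    by apply: filterI => //; apply: derivable_nbhs_lt => //; exact: (proj2 Kh).
  move=> [u n] [/= [Ku hu] _]; rewrite cmodM cmodX; apply: le_lt_trans hu.
  by apply: ler_piMl; rewrite ?cmod_ge0 // exprn_ile1 ?cmod_ge0 ?f1le.
pose H w := f1 w ^+ n * h w.
have KH : alg_A K H by apply: alg_A_mul Kh; exact: alg_A_exp.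
have Hz : cmod (H z) = 1.
  have zb : z - b != 0 by rewrite -cmod_gt0.
  have fzN : f z != 0 by rewrite -cmod_gt0.
  by rewrite /H /f1 /h !divff // ?expr1n ?mul1r ?cmod1 // pnatr_eq0.
have [q /andP[q0 q1] Hq] : exists2 q : R, 0 <= q < 1 & forall w, A w -> cmod (H w) <= q.
  have [A0|/set0P A0] := eqVneq A set0; first by exists 0; rewrite ?lexx ?ltr01 // A0.
  have AH : alg_A A H by apply: alg_A_sub_set KH => w /AK/interior_subset.
  have [v Av vmax] := alg_A_cmod_max A0 cA AH.
  exists (cmod (H v)) => //; rewrite cmod_ge0; exact: nA.
(* A high power absorbs the constant [2] of [cmod_center_le]. *)
have /filter_ex[N HN] : \forall n \near \oo, q ^+ n < 2^-1.
  by apply: expr_small; rewrite ?q0 ?invr_gt0.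
have : cmod (H z ^+ N) <= 2 * q ^+ N.
  apply: (@cmod_center_le _ (fun w => H w ^+ N) z r) => // w wr.
    by apply: (proj2 (alg_A_exp N KH)); exact: discK.
  by rewrite cmodX lerXn2r ?nnegrE ?cmod_ge0 // Hq.
by rewrite cmodX Hz expr1n; lra.
Qed.

Lemma max_setP K f z : K !=set0 -> compact K -> alg_A K f ->
  max_set K f z <-> K z /\ forall w, K w -> cmod (f w) <= cmod (f z).
Proof.
move=> K0 cK Kf; have [c Kc cmax] := alg_A_cmod_max K0 cK Kf.
have ubK : ubound [set cmod (f w) | w in K] (cmod (f c)).
  by move=> _ [w Kw <-]; exact: cmax.
have supE : sup_norm K f = cmod (f c).
  apply/eqP; rewrite eq_le /sup_norm ge_sup //=; last by exists (cmod (f c)), c.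
  by apply: ub_le_sup; [exists (cmod (f c))|exists c].
rewrite /max_set /= supE; split=> [[Kz ->]//|[Kz zmax]].
by split => //; apply/eqP; rewrite eq_le cmax // zmax.
Qed.
End MaximumModulus.

(** * Uniform limits *)

Section UniformLimits.
Context {R : realType}.
Implicit Types (p d z w c : R[i]) (K : set R[i]^o) (f g : R[i]^o -> R[i]^o).

Lemma derivable_mul_sub (k : R[i]^o -> R[i]^o) z :
  {for z, continuous k} -> derivable (fun w : R[i]^o => (w - z) * k w) z 1.
Proof.
move=> kz; apply/derivable_cmodP; exists (k z) => e e0.
have /kz/nbhs_cmodP[r r0 kr] : nbhs (k z) [set y : R[i]^o | cmod (y - k z) < e].
  by apply/nbhs_cmodP; exists e.
exists r => // w /kr /= kw; rewrite subrr mul0r subr0 (mulrC (k z)) -mulrBr.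
by rewrite cmodM mulrC ler_wpM2r ?cmod_ge0 // ltW.
Qed.

Lemma disc_boundary_le f z (r C : R) : 0 < r ->
  (forall w, cmod (w - z) <= r -> derivable f w 1) ->
  (forall w, cmod (w - z) = r -> cmod (f w) <= C) ->
  forall w, cmod (w - z) <= r -> cmod (f w) <= C.
Proof.
move=> r0 df fC w wr.
pose D : set R[i]^o := [set u | 0 <= cmod (u - z) <= r].
have DE u : D u <-> cmod (u - z) <= r by rewrite /D /= cmod_ge0.
have [||u [/DE ur [_ nu] /(_ w)]] := @frontier_maximum _ D f _ (@compact_annulus _ z 0 r).
- by exists z; apply/DE; rewrite subrr cmod0 ltW.
- by apply: alg_A_derivable => u /DE; exact: df.
move=> /(_ (proj2 (DE w) wr))/le_trans; apply; apply: fC.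
apply/eqP; rewrite eq_le ur leNgt; apply/negP => ur'; apply: nu.
apply/interior_cmodP; exists (r - cmod (u - z)); first by rewrite subr_gt0.
by move=> v vu; apply/DE; have := cmod_tri v u z; lra.
Qed.

(* The maximum principle is applied to [(w - z) ((f w - f z) / (w - z)) ^+ n],
   which is differentiable at [z] although nothing is known on the second
   derivative of [f]; then [n] tends to infinity. *)
Lemma schwarz f z (r M : R) : 0 < r ->
  (forall w, cmod (w - z) <= r -> derivable f w 1) ->
  (forall w, cmod (w - z) <= r -> cmod (f w) <= M) ->
  forall w, cmod (w - z) <= r -> cmod (f w - f z) <= 2 * M / r * cmod (w - z).
Proof.
move=> r0 df fM w wr.
have [->|wz] := eqVneq w z; first by rewrite !subrr cmod0 mulr0.
have zr : cmod (z - z) <= r by rewrite subrr cmod0 ltW.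
have M0 : 0 <= M := le_trans (cmod_ge0 _) (fM z zr).
have /derivable_cmodP[D fD] := df z zr.
(* The value [D] at [z] makes the quotient continuous there, which is what [derivable_mul_sub] asks
   for. *)
pose G (u : R[i]^o) : R[i]^o := if u == z then D else (f u - f z) / (u - z).
have Gz : {for z, continuous G}.
  move=> V /nbhs_cmodP[e e0 eV].
  have [s s0 fs] := fD (e / 2) (divr_gt0 e0 (ltr0Sn _ _)).
  apply/nbhs_cmodP; exists s => // u us; apply: eV.
  rewrite /G eqxx; case: eqVneq => [_|uz]; first by rewrite subrr cmod0.
  have uz0 : u - z != 0 by rewrite subr_eq0.
  apply: (@le_lt_trans _ _ (e / 2)); last lra.
  rewrite -(ler_pM2r (x := cmod (u - z))) ?cmod_gt0 // -cmodM.
  rewrite (_ : _ * (u - z) = f u - f z - D * (u - z)) ?fs //.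
  by field.
have derG n (u : R[i]^o) : cmod (u - z) <= r ->
    derivable (fun v : R[i]^o => (v - z) * G v ^+ n) u 1.
  move=> ur; have [->|uz] := eqVneq u z.
    apply: derivable_mul_sub.
    elim: n => [|n IH]; first exact: cst_continuous.
    have -> : (fun v => G v ^+ n.+1) = (fun v => G v * G v ^+ n).
      by apply/funext => v; rewrite exprS.
    exact: (cvgM Gz IH).
  have uz0 : 0 < cmod (u - z) by rewrite cmod_gt0 subr_eq0.
  pose H (v : R[i]^o) : R[i]^o := (v - z) * ((f v - f z) / (v - z)) ^+ n.
  have HG : {near (u : R[i]^o), H =1 (fun v => (v - z) * G v ^+ n)}.
    apply/nbhs_cmodP; exists (cmod (u - z)) => // v vu.
    have vz : v != z by apply/eqP => vz; move: vu; rewrite vz (cmodC z u) ltxx.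
    by rewrite /H /G (negbTE vz).
  apply: (near_eq_derivable HG).
  apply: derivableM.
    by apply: derivableB; [exact: derivable_id|exact: derivable_cst].
  apply: derivable_exp; apply: derivableM.
    by apply: derivableB; [exact: df|exact: derivable_cst].
  apply: derivableV; first by rewrite subr_eq0.
  by apply: derivableB; [exact: derivable_id|exact: derivable_cst].
pose Q := 2 * M / r.
have Q0 : 0 <= Q by rewrite !mulr_ge0 ?invr_ge0 // ltW.
have wz0 : 0 < cmod (w - z) by rewrite cmod_gt0 subr_eq0.
have bound n : cmod (w - z) * cmod (G w) ^+ n <= r * Q ^+ n.
  rewrite -cmodX -cmodM; apply: (disc_boundary_le r0 (derG n)) => // u ur.
  rewrite cmodM ur cmodX; apply: ler_wpM2l; first exact: ltW.
  rewrite lerXn2r ?nnegrE ?cmod_ge0 //.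
  rewrite /G; case: eqVneq => [uz|uz].
    by move: ur; rewrite uz subrr cmod0; lra.
  rewrite cmodM cmodV ur; apply: ler_wpM2r; first by rewrite invr_ge0 ltW.
  apply: le_trans (cmodB _ _) _.
  have := fM u; have := fM z; rewrite ur => /(_ zr) + /(_ (lexx _)); lra.
have GQ : cmod (G w) <= Q.
  rewrite leNgt; apply/negP => QG; have G0 : 0 < cmod (G w) by lra.
  have /filter_ex[n] : \forall n \near \oo, (Q / cmod (G w)) ^+ n < cmod (w - z) / r.
    apply: expr_small; last exact: divr_gt0.
    by rewrite divr_ge0 ?cmod_ge0 //= ltr_pdivrMr // mul1r.
  rewrite expr_div_n ltr_pdivrMr ?exprn_gt0 // mulrAC ltr_pdivlMr // mulrC.
  by have := bound n; lra.
move: GQ; rewrite /G (negbTE wz) cmodM cmodV ler_pdivrMr //.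
Qed.

(** The limit is the supremum of the lower bounds [u n - e n], each of which is below every
    [u m + e m]. *)
Lemma cauchy_real (u e : nat -> R) :
  (forall n m, (n <= m)%N -> `|u m - u n| <= e n) ->
  exists l, forall n, `|l - u n| <= e n.
Proof.
move=> ue.
have H n m : u n - e n <= u m + e m.
  have [/ue|/ltnW/ue] := leqP n m; rewrite ler_norml => /andP[a b].
    by have := ue m m (leqnn m); rewrite subrr normr0; lra.
  by have := ue n n (leqnn n); rewrite subrr normr0; lra.
exists (sup (range (fun n => u n - e n))) => n; rewrite ler_distl; apply/andP; split.
  by apply: ub_le_sup; [exists (u 0%N + e 0%N) => _ [m _ <-]|exists n].
by apply: ge_sup; [exists (u 0%N - e 0%N), 0%N|move=> _ [m _ <-]].
Qed.

Lemma cauchy_complex (u : nat -> R[i]) (e : nat -> R) :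
  (forall n m, (n <= m)%N -> cmod (u m - u n) <= e n) ->
  exists l, forall n, cmod (l - u n) <= 2 * e n.
Proof.
move=> ue.
have [|a aE] := @cauchy_real (fun n => Re (u n)) e.
  by move=> n m /ue; apply: le_trans; rewrite -raddfB; exact: Re_le_cmod.
have [|b bE] := @cauchy_real (fun n => Im (u n)) e.
  by move=> n m /ue; apply: le_trans; rewrite -raddfB; exact: Im_le_cmod.
exists (a +i* b) => n; apply: le_trans (cmod_le_ReIm _) _.
by rewrite !raddfB /=; have := aE n; have := bE n; lra.
Qed.

Lemma derivative_le g z D (r L : R) : 0 < r ->
  (forall w, cmod (w - z) <= r -> cmod (g w - g z) <= L * cmod (w - z)) ->
  (forall e : R, 0 < e -> exists2 s : R, 0 < s & forall w, cmod (w - z) < s ->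
     cmod (g w - g z - D * (w - z)) <= e * cmod (w - z)) ->
  cmod D <= L.
Proof.
move=> r0 gL gD; apply/ler_addgt0Pr => e e0; have [s s0 gs] := gD e e0.
pose t := Num.min r (s / 2).
have t0 : 0 < t by rewrite lt_min r0 divr_gt0.
have wz : cmod (z + t%:C - z) = t by rewrite addrAC subrr add0r cmod_real // ltW.
have := gL (z + t%:C); have := gs (z + t%:C); rewrite wz.
have -> : t <= r by rewrite ge_min lexx.
have -> : t < s by rewrite /t gt_min; apply/orP; right; lra.
move=> /(_ isT) h1 /(_ isT) h2.
rewrite -(ler_pM2r t0) -[X in _ * X <= _]wz -cmodM.
have := cmodB (g (z + t%:C) - g z) (g (z + t%:C) - g z - D * (z + t%:C - z)).
by rewrite opprB addrC subrK; lra.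
Qed.

(** At an interior point, [schwarz] applied to [F m - F n] gives a Lipschitz bound tending to zero
    with [e n]. So the derivatives form a Cauchy sequence, and their limit is the derivative of the
    limit function. The factor [2] comes from treating real and imaginary parts separately. *)
Lemma alg_A_uniform_limit K (F : nat -> R[i]^o -> R[i]^o) (e : nat -> R) :
  (forall n, alg_A K (F n)) ->
  (forall n m z, (n <= m)%N -> K z -> cmod (F m z - F n z) <= e n) ->
  (forall d : R, 0 < d -> \forall n \near \oo, e n < d) ->
  exists2 f, alg_A K f & forall n z, K z -> cmod (f z - F n z) <= 2 * e n.
Proof.
move=> KF Fe e_0.
have lim z : exists l, K z -> forall n, cmod (l - F n z) <= 2 * e n.
  have [Kz|nKz] := pselect (K z); last by exists 0 => /nKz.
  have [|l lE] := @cauchy_complex (fun n => F n z) e; last by exists l.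
  by move=> n m nm; exact: Fe.
have [f fF] := choice lim; exists f; last by move=> n z /fF.
split=> [|z Kz].
  apply/within_continuousP => z Kz d d0.
  have /filter_ex[n en] := e_0 (d / 8) (divr_gt0 d0 (ltr0Sn _ _)).
  have [/within_continuousP/(_ z Kz (d / 2) (divr_gt0 d0 (ltr0Sn _ _)))[r r0 Fr] _] := KF n.
  exists r => // w Kw /(Fr w Kw) Fw; have := fF w Kw n; have := fF z Kz n.
  have := cmod_tri (f w) (F n w) (f z); have := cmod_tri (F n w) (F n z) (f z).
  by rewrite (cmodC (F n z)); lra.
have /interior_cmodP[r2 r20 rK] := Kz.
pose r := r2 / 2; have r0 : 0 < r by rewrite divr_gt0.
have discK w : cmod (w - z) <= r -> K° w.
  move=> wz; apply/interior_cmodP; exists r => // u uw; apply: rK.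
  by have := cmod_tri u w z; move: wz uw; rewrite /r; lra.
have discK' w : cmod (w - z) <= r -> K w by move=> /discK/interior_subset.
have zr : cmod (z - z) <= r by rewrite subrr cmod0 ltW.
have Fder n : exists D, forall d : R, 0 < d -> exists2 s : R, 0 < s &
    forall w, cmod (w - z) < s ->
      cmod (F n w - F n z - D * (w - z)) <= d * cmod (w - z).
  by apply/derivable_cmodP; exact: (proj2 (KF n)).
have {Fder}[D FD] := choice Fder.
have lip n m w : (n <= m)%N -> cmod (w - z) <= r ->
    cmod ((F m w - F n w) - (F m z - F n z)) <= 2 * e n / r * cmod (w - z).
  move=> nm wr; apply: (@schwarz (fun u => F m u - F n u) z r (e n)) => // u ur.
    by apply: derivableB; apply: (proj2 (KF _)); exact: discK.
  by apply: Fe => //; exact: discK'.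
have [|D0 D0E] := @cauchy_complex D (fun n => 2 * e n / r).
  move=> n m nm; apply: (derivative_le (g := fun w => F m w - F n w) r0).
    by move=> w; exact: lip.
  move=> d d0; have d20 : 0 < d / 2 by rewrite divr_gt0.
  have [s1 s10 F1] := FD m _ d20; have [s2 s20 F2] := FD n _ d20.
  exists (Num.min s1 s2); first by rewrite lt_min s10.
  move=> w; rewrite lt_min => /andP[/F1 h1 /F2 h2].
  rewrite (_ : _ - _ = F m w - F m z - D m * (w - z) - (F n w - F n z - D n * (w - z))).
    by apply: le_trans (cmodB _ _) _; lra.
  by ring.
(* Passage to the limit [m -> oo] in [lip]. *)
have flip n w : cmod (w - z) <= r ->
    cmod ((f w - F n w) - (f z - F n z)) <= 2 * e n / r * cmod (w - z).
  move=> wr; apply/ler_addgt0Pr => d d0.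
  have /filter_ex[m [em nm]] : \forall m \near \oo, e m < d / 4 /\ (n <= m)%N.
    apply: filterI; first by apply: e_0; exact: divr_gt0.
    exact: nbhs_infty_ge.
  have := lip n m w nm wr; have := fF w (discK' w wr) m; have := fF z (discK' z zr) m.
  rewrite (_ : f w - F n w - _ = (f w - F m w) - (f z - F m z) +
    (F m w - F n w - (F m z - F n z))); last by ring.
  have := cmodD (f w - F m w - (f z - F m z)) (F m w - F n w - (F m z - F n z)).
  have := cmodB (f w - F m w) (f z - F m z).
  lra.
apply/derivable_cmodP; exists D0 => d d0.
(* The errors are [2 * e n / r] from [flip] and [4 * e n / r] from [D0E], together at most [d / 2];
   the other half is left for [F n]. *)
have /filter_ex[n en] : \forall n \near \oo, e n < d * r / 12.
  by apply: e_0; rewrite divr_gt0 // mulr_gt0.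
have er : 6 * (e n / r) <= d / 2.
  by rewrite mulrA ler_pdivrMr //; lra.
have [s s0 Fs] := FD n (d / 2) (divr_gt0 d0 (ltr0Sn _ _)).
exists (Num.min s r); first by rewrite lt_min s0.
move=> w; rewrite lt_min => /andP[/Fs h1 /ltW wr].
have := flip n w wr; have := D0E n.
rewrite (_ : f w - f z - _ = (f w - F n w - (f z - F n z)) +
  (F n w - F n z - D n * (w - z)) - (D0 - D n) * (w - z)); last by ring.
move=> h2 h3; apply: le_trans (cmodB _ _) _.
apply: le_trans (lerD (cmodD _ _) (lexx _)) _; rewrite cmodM.
have := ler_wpM2r (cmod_ge0 (w - z)) h2; have := ler_wpM2r (cmod_ge0 (w - z)) er.
by lra.
Qed.
End UniformLimits.

(** * Peak points *)

Section SquareRoot.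
Context {R : realType}.
Implicit Types (a b p q z u v : R[i]) (K : set R[i]^o) (f g : R[i]^o -> R[i]^o).

Lemma sqrt_right_half_plane u : 0 < Re u -> exists s, s ^+ 2 = u /\ 0 < Re s.
Proof.
move=> u0; pose s := sqrtc u; have s2 : s ^+ 2 = u := sqr_sqrtc u.
have [s0|s0] := ltP 0 (Re s); first by exists s.
exists (- s); rewrite sqrrN s2 raddfN /= oppr_gt0; split => //.
rewrite lt_neqAle s0 andbT; apply/eqP => Rs.
move: u0; rewrite -s2 expr2; case: (s) Rs => x y /= ->.
by have := sqr_ge0 y; lra.
Qed.

(** The root is chosen pointwise in the right half-plane. Since [g u - g z] factors as
    [(w u - w z) * (w u + w z)] and the second factor has real part at least [Re (w z)], regularity
    passes from [g] to [w]. *)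
Lemma alg_A_sqrt K g : alg_A K g -> (forall z, K z -> 0 < Re (g z)) ->
  exists w, alg_A K w /\ forall z, K z -> w z ^+ 2 = g z /\ 0 < Re (w z).
Proof.
move=> [/within_continuousP cg dg] g0.
have /choice[w wP] : forall z, exists s : R[i], K z -> s ^+ 2 = g z /\ 0 < Re s.
  move=> z; have [/g0/sqrt_right_half_plane[s sP]|nKz] := pselect (K z).
    by exists s.
  by exists 0 => /nKz.
exists w; split; last exact: wP.
have wB u z : K u -> K z -> Re (w z) * cmod (w u - w z) <= cmod (g u - g z).
  move=> /wP[<- u0] /wP[<- z0]; rewrite subr_sqr cmodM mulrC.
  rewrite ler_wpM2l ?cmod_ge0 //.
  apply: le_trans (Re_le_cmod _); apply: le_trans (ler_norm _).
  by rewrite raddfD /=; lra.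
split=> [|z Kz].
  apply/within_continuousP => z Kz e e0; have [_ z0] := wP z Kz.
  have [r r0 gr] := cg z Kz (Re (w z) * e) (mulr_gt0 z0 e0).
  exists r => // u Ku /(gr u Ku) gu; rewrite -(ltr_pM2l z0).
  exact: le_lt_trans (wB u z Ku Kz) gu.
have Kz' := interior_subset Kz; have [wz z0] := wP z Kz'.
set rho := Re (w z) in z0.
have rhoP : rho <= cmod (w z).
  by apply: le_trans (Re_le_cmod _); exact: ler_norm.
have wz0 : w z != 0 by rewrite -cmod_gt0; lra.
have /derivable_cmodP[D gD] := dg z Kz.
have /interior_cmodP[r1 r10 rK] := Kz.
apply/derivable_cmodP; exists (D / (2 * w z)) => e e0.
have [r2 r20 g2] := gD (e * rho) (mulr_gt0 e0 z0).
have [r3 r30 g3] := gD 1 ltr01.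
(* [L] is a Lipschitz constant of [w] at [z]; the radius [e * rho / L ^+ 2] makes the quadratic term
   [(w u - w z) ^+ 2] at most [e * rho * cmod (u - z)]. *)
pose L := (cmod D + 1) / rho.
have L0 : 0 < L by rewrite divr_gt0 //; have := cmod_ge0 D; lra.
exists (Num.min (Num.min r1 r2) (Num.min r3 (e * rho / L ^+ 2))).
  rewrite !lt_min r10 r20 r30 /=; apply: divr_gt0; first exact: mulr_gt0.
  exact: exprn_gt0.
move=> u; rewrite !lt_min => /andP[/andP[/rK Ku /g2 h2] /andP[/g3 h3]].
rewrite ltr_pdivlMr ?exprn_gt0 // => us; have [wu _] := wP u Ku.
have -> : w u - w z - D / (2 * w z) * (u - z) =
    ((g u - g z - D * (u - z)) - (w u - w z) ^+ 2) / (2 * w z).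
  by rewrite -wu -wz; field.
rewrite cmodM cmodV cmodM cmod2 ler_pdivrMr; last by rewrite mulr_gt0 //; lra.
apply: le_trans (cmodB _ _) _; rewrite cmodX.
have lip : cmod (w u - w z) <= L * cmod (u - z).
  rewrite /L mulrAC ler_pdivlMr // mulrC; apply: le_trans (wB u z Ku Kz') _.
  have := cmodD (g u - g z - D * (u - z)) (D * (u - z)).
  by rewrite subrK cmodM; lra.
have lip2 : cmod (w u - w z) ^+ 2 <= e * rho * cmod (u - z).
  apply: (@le_trans _ _ ((L * cmod (u - z)) ^+ 2)).
    by rewrite lerXn2r ?nnegrE ?cmod_ge0 // mulr_ge0 ?cmod_ge0 // ltW.
  rewrite exprMn [X in _ * X]expr2 mulrA ler_wpM2r ?cmod_ge0 //.
  by rewrite mulrC ltW.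
apply: le_trans (lerD h2 lip2) _.
have := ler_wpM2r (mulr_ge0 (ltW e0) (cmod_ge0 (u - z))) rhoP; lra.
Qed.

Lemma Re_gt0_near1 u : cmod (u - 1) < 1 -> 0 < Re u.
Proof.
move=> u1; have := Re_le_cmod (u - 1); rewrite raddfB /=.
by rewrite ler_norml => /andP[+ _]; lra.
Qed.

Lemma ReV_gt0 u : 0 < Re u -> 0 < Re u^-1.
Proof.
case: u => x y /= x0.
by rewrite divr_gt0 //; have := sqr_ge0 y; have := exprn_gt0 2 x0; lra.
Qed.

Lemma cmod_sub1_le_sqr u : 0 <= Re u -> cmod (u - 1) <= cmod (u ^+ 2 - 1).
Proof.
move=> u0; rewrite -[X in u ^+ 2 - X](expr1n _ 2) subr_sqr cmodM.
apply: ler_peMr; first exact: cmod_ge0.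
apply: le_trans (Re_le_cmod _); apply: le_trans (ler_norm _).
by rewrite raddfD /=; lra.
Qed.

Lemma sqr_near1 u z p q (t : R) : z != q -> u ^+ 2 * (z - q) = z - p ->
  cmod (q - p) <= t * cmod (z - q) -> cmod (u ^+ 2 - 1) <= t.
Proof.
move=> zq uE qp; have zq0 : 0 < cmod (z - q) by rewrite cmod_gt0 subr_eq0.
rewrite -(ler_pM2r zq0) -cmodM mulrBl mul1r uE.
by rewrite (_ : _ - _ = q - p) //; ring.
Qed.

(* [w] is a branch of [sqrt ((z - a) / (z - b))] with positive real part far from [a];
   [b] is reached from [a] outside [K], multiplying by [sqrt ((z - p) / (z - q))]
   at each small step from [p] to [q]. *)
Lemma sqrt_branch K a (d : R) : compact K -> connected (~` K) -> ~ K a -> 0 < d ->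
  exists b (w : R[i]^o -> R[i]^o), [/\ d / 2 <= cmod (b - a) < d, ~ K b, alg_A K w,
    forall z, K z -> w z ^+ 2 * (z - b) = z - a &
    forall z, K z -> 5 * d <= cmod (z - a) -> 0 < Re (w z)].
Proof.
move=> cK conK nKa d0; apply: contrapT => nob.
(* [S] collects the points reachable from [a]. If none is at distance [d / 2] or more, [S] is open
   and closed in the complement of [K], hence equal to it, although the complement is unbounded. *)
pose S : set R[i]^o := [set b | [/\ ~ K b, cmod (b - a) < d & exists w,
  [/\ alg_A K w, forall z, K z -> w z ^+ 2 * (z - b) = z - a &
    forall z, K z -> 5 * d <= cmod (z - a) -> 0 < Re (w z)]]].
have Sd b : S b -> cmod (b - a) < d / 2.
  move=> [nKb bd [w [Kw wE w0]]]; rewrite ltNge; apply/negP => db; apply: nob.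
  by exists b, w; split => //; rewrite db.
have neqK z q : K z -> ~ K q -> z != q.
  by move=> Kz nKq; apply/eqP => zq; apply: nKq; rewrite -zq.
have step p q : S p -> ~ K q -> cmod (q - a) < d ->
    (forall z, K z -> 0 < Re ((z - p) / (z - q))) -> S q.
  move=> [nKp pd [w [Kw wE w0]]] nKq qd pq; split => //.
  have Kg : alg_A K (fun z => (z - p) / (z - q)).
    apply: alg_A_mul; first exact: alg_A_sub (alg_A_id _) (alg_A_cst _ _).
    apply: alg_A_inv; first exact: alg_A_sub (alg_A_id _) (alg_A_cst _ _).
    by move=> z /neqK/(_ nKq); rewrite subr_eq0.
  have [s [Ks sP]] := alg_A_sqrt Kg pq.
  exists (fun z => w z * s z); split => [|z Kz|z Kz za].
  - exact: alg_A_mul.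
  - have zq := neqK z q Kz nKq; have [sE _] := sP z Kz.
    rewrite exprMn sE -wE //; field; first by rewrite subr_eq0.
  - have [sE s0] := sP z Kz; have zq := neqK z q Kz nKq; have zp := neqK z p Kz nKp.
    have := cmod_tri z p a; have := cmod_tri z q a => tq tp.
    (* Both [p] and [q] are at distance at least [4 * d] from [z], while [a] and [p] are [d]-close
       and [p] and [q] are [2 * d]-close. The product then differs from [1] by at most
       [1/8 + 1/4 + 1/2 < 1], so its real part stays positive. *)
    have w1 : cmod (w z - 1) <= 1 / 4.
      apply: le_trans (cmod_sub1_le_sqr (ltW (w0 z Kz za))) _.
      by apply: sqr_near1 zp (wE z Kz) _; lra.
    have s1 : cmod (s z - 1) <= 1 / 2.
      apply: le_trans (cmod_sub1_le_sqr (ltW s0)) _.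
      apply: (sqr_near1 (p := p) zq); first by rewrite sE divfK // subr_eq0.
      by have := cmod_tri q a p; rewrite (cmodC a p); lra.
    apply: Re_gt0_near1.
    rewrite (_ : w z * s z - 1 = (w z - 1) * (s z - 1) + (w z - 1) + (s z - 1)).
      have := cmodD ((w z - 1) * (s z - 1) + (w z - 1)) (s z - 1).
      have := cmodD ((w z - 1) * (s z - 1)) (w z - 1); rewrite cmodM.
      have : cmod (w z - 1) * cmod (s z - 1) <= 1 / 4 * (1 / 2).
        by apply: ler_pM; rewrite ?cmod_ge0.
      by lra.
    by ring.
have Sa : S a.
  split => //; first by rewrite subrr cmod0.
  exists (fun=> 1); split => [|z _|z _ _]; first exact: alg_A_cst.
    by rewrite expr1n mul1r.
  by rewrite /= ltr01.
have /closed_cmodP clK := compact_closed_cmod cK.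
have far p r z : (forall q, cmod (q - p) < r -> ~ K q) -> K z -> r <= cmod (z - p).
  by move=> rK Kz; rewrite leNgt; apply/negP => /rK.
have SK : S = ~` K.
  apply: conK; first by exists a.
    exists S; last first.
      by apply/seteqP; split=> [p Sp|p [_]//]; split => //; case: Sp.
    rewrite openE => p Sp; have [nKp _ _] := Sp.
    have [r r0 rK] := clK p nKp; apply/interior_cmodP.
    exists (Num.min r (d / 2)); first by rewrite lt_min r0 divr_gt0.
    move=> q; rewrite lt_min => /andP[qr qd]; apply: (step p) => //.
    - exact: rK.
    - by have := cmod_tri q p a; have := Sd p Sp; lra.
    move=> z Kz; have zp := far p r z rK Kz.
    have zp0 : z - p != 0 by rewrite -cmod_gt0; lra.
    (* The known distance is the one from [z] to [p], so the inverse quotient is the one shown to be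
       near [1]. *)
    rewrite -invf_div; apply: ReV_gt0; apply: Re_gt0_near1.
    rewrite (_ : _ - 1 = (p - q) / (z - p)); last by field.
    by rewrite cmodM cmodV ltr_pdivrMr ?cmod_gt0 // mul1r (cmodC p); lra.
  exists (closure S); first exact: closed_closure.
  apply/seteqP; split=> [p Sp|p [nKp clp]].
    by split; [case: Sp|exact: subset_closure].
  have [r r0 rK] := clK p nKp.
  have /clp[q [Sq]] : nbhs (p : R[i]^o) [set q : R[i]^o | cmod (q - p) < Num.min r (d / 4)].
    by apply/nbhs_cmodP; exists (Num.min r (d / 4)) => //; rewrite lt_min r0 divr_gt0.
  rewrite /= lt_min => /andP[qr qd]; apply: (step q) => //.
    by have := cmod_tri p q a; have := Sd q Sq; rewrite (cmodC p q); lra.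
  move=> z Kz; have zp := far p r z rK Kz.
  have zp0 : z - p != 0 by rewrite -cmod_gt0; lra.
  apply: Re_gt0_near1; rewrite (_ : _ - 1 = (p - q) / (z - p)); last by field.
  by rewrite cmodM cmodV ltr_pdivrMr ?cmod_gt0 // mul1r (cmodC p); lra.
have [B B0 KB] := compact_cmod_bounded cK.
(* A point outside [K] at distance more than [d / 2] from [a]. *)
pose N : R := B + cmod a + d.
have N0 : 0 <= N by have := cmod_ge0 a; rewrite /N; lra.
have : S N%:C.
  rewrite SK => /KB; rewrite cmod_real // /N; have := cmod_ge0 a; lra.
move=> /Sd; have := cmod_lb N%:C (- a); rewrite cmodN cmod_real // /N; lra.
Qed.
End SquareRoot.

(** * Construction of peak functions and comparison of the boundaries *)

Section PeakPoints.
Context {R : realType}.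
Implicit Types (a b p q z u v : R[i]) (K : set R[i]^o) (f g h : R[i]^o -> R[i]^o).

Lemma quasi_peak K z0 (rho : R) : compact K -> connected (~` K) -> K z0 ->
  ~ K° z0 -> 0 < rho ->
  exists h, [/\ alg_A K h, h z0 = 1, forall z, K z -> cmod (h z) <= 146 &
    forall z, K z -> rho <= cmod (z - z0) -> cmod (h z) <= 1 / 2].
Proof.
move=> cK conK Kz0 nz0 rho0; pose d := rho / 7; have d0 : 0 < d by rewrite divr_gt0.
have [a [nKa az0]] : exists a, ~ K a /\ cmod (a - z0) < d / 20.
  apply: contrapT => na; apply: nz0; apply/interior_cmodP.
  exists (d / 20) => [|a ad]; first by rewrite divr_gt0.
  by apply: contrapT => nKa; apply: na; exists a.
have [b [w [/andP[bd1 bd2] nKb Kw wE w0]]] := sqrt_branch cK conK nKa d0.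
(* Far from [a] the real part of [w] is positive. Near [a], the identity
   [(w - 1) * (1 + w) * (z - b) = b - a] has right side of modulus at least [d / 2], while
   [cmod (w - 1) <= 3] and [cmod (z - b) <= 6 * d]; note [36 = 2 * 3 * 6]. *)
have wB z : K z -> 1 / 36 <= cmod (1 + w z).
  move=> Kz; have [za|za] := leP (5 * d) (cmod (z - a)).
    apply: (@le_trans _ _ 1); first lra.
    apply: le_trans (Re_le_cmod _); apply: le_trans (ler_norm _).
    by have := w0 z Kz za; rewrite raddfD /=; lra.
  rewrite leNgt; apply/negP => w1.
  have : (w z - 1) * (1 + w z) * (z - b) = b - a.
    rewrite (_ : _ * (z - b) = w z ^+ 2 * (z - b) - (z - b)); last by ring.
    by rewrite wE //; ring.
  move=> /(congr1 (@cmod R)); rewrite !cmodM => E.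
  have zb : cmod (z - b) <= 6 * d.
    by have := cmod_tri z a b; rewrite (cmodC a b); lra.
  have wm : cmod (w z - 1) <= 3.
    have := cmodB (1 + w z) 2; rewrite cmod2 (_ : _ - 2 = w z - 1); last by ring.
    by lra.
  have wp : cmod (w z - 1) * cmod (1 + w z) <= 3 * cmod (1 + w z).
    by rewrite ler_wpM2r ?cmod_ge0.
  have : cmod (w z - 1) * cmod (1 + w z) * cmod (z - b) <= 3 * cmod (1 + w z) * (6 * d).
    by apply: ler_pM; rewrite ?mulr_ge0 ?cmod_ge0.
  have : cmod (1 + w z) * d < 1 / 36 * d by rewrite ltr_pM2r.
  by rewrite E; lra.
pose f z := (1 - w z) / (1 + w z).
have w1 z : K z -> 1 + w z != 0.
  by move=> /wB wz; rewrite -cmod_gt0; lra.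
have Kf : alg_A K f.
  apply: alg_A_mul; first exact: alg_A_sub (alg_A_cst _ _) Kw.
  by apply: alg_A_inv w1; exact: alg_A_add (alg_A_cst _ _) Kw.
(* [73 = 2 * 36 + 1]; the final division by [f z0], of modulus at least [1 / 2], gives [146]. *)
have fB z : K z -> cmod (f z) <= 73.
  move=> Kz; have := wB z Kz => wz.
  rewrite (_ : f z = 2 / (1 + w z) - 1); last by rewrite /f; field; exact: w1.
  apply: le_trans (cmodB _ _) _; rewrite cmodM cmodV cmod1 cmod2.
  suff : 2 / cmod (1 + w z) <= 72 by lra.
  by rewrite ler_pdivrMr; lra.
have f0 : 1 / 2 <= cmod (f z0).
  (* [cmod (z0 - a) < d / 20] and [cmod (z0 - b) >= 9 / 20 * d] give [cmod (w z0) ^+ 2 <= 1 / 9]. *)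
  have wz0 : cmod (w z0) <= 1 / 3.
    rewrite -(ler_pXn2r (n := 2)) ?nnegrE ?cmod_ge0 ?divr_ge0 //.
    have zb : 9 / 20 * d <= cmod (z0 - b).
      have := cmod_tri b z0 a; rewrite (cmodC b z0) (cmodC z0 a); lra.
    have /(congr1 (@cmod R)) := wE z0 Kz0; rewrite cmodM cmodX (cmodC z0 a) => E.
    have zb0 : 0 < cmod (z0 - b) by lra.
    by rewrite -(ler_pM2r zb0) E; lra.
  rewrite cmodM cmodV ler_pdivlMr; last by have := wB z0 Kz0; lra.
  have := cmodD 1 (w z0); have := cmod_lb 1 (- w z0); rewrite cmodN cmod1; lra.
have ffar z : K z -> rho <= cmod (z - z0) -> cmod (f z) <= 1 / 5.
  move=> Kz; have -> : rho = 7 * d by rewrite /d; field.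
  move=> zz0; have za : 6 * d <= cmod (z - a).
    by have := cmod_tri z a z0; lra.
  have zb : 5 * d <= cmod (z - b) by have := cmod_tri z b a; lra.
  have wz0 : 0 < Re (w z) by apply: w0 => //; lra.
  have zNb : z != b by rewrite -subr_eq0 -cmod_gt0; lra.
  have : cmod (w z - 1) <= 1 / 5.
    apply: le_trans (cmod_sub1_le_sqr (ltW wz0)) _.
    by apply: (sqr_near1 zNb (wE z Kz)); lra.
  have wz1 : 1 <= cmod (1 + w z).
    apply: le_trans (Re_le_cmod _); apply: le_trans (ler_norm _).
    by rewrite raddfD /=; lra.
  rewrite cmodM cmodV cmodC ler_pdivrMr; lra.
have fz0 : 0 < cmod (f z0) by lra.
exists (fun z => f z / f z0); split.
- exact: alg_A_mul Kf (alg_A_cst _ _).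
- by rewrite divff // -cmod_gt0.
- move=> z Kz; rewrite cmodM cmodV ler_pdivrMr //; have := fB z Kz; lra.
- move=> z Kz zz0; rewrite cmodM cmodV ler_pdivrMr //; have := ffar z Kz zz0; lra.
Qed.

(* The peak function is [\sum_n (1 - s) s ^+ n h_n], where [1 - s = 1 / (2 M)]
   and [h_n] is small off a neighbourhood of [z0] on which the partial sum of
   order [n] is almost at most its value [1 - s ^+ n] at [z0]. *)
Lemma quasi_peak_peak K z0 (M : R) : K z0 -> 1 <= M ->
  (forall rho : R, 0 < rho -> exists h, [/\ alg_A K h, h z0 = 1,
     forall z, K z -> cmod (h z) <= M &
     forall z, K z -> rho <= cmod (z - z0) -> cmod (h z) <= 1 / 2]) ->
  peak_points K z0.
Proof.
move=> Kz0 M1 qp; pose s := 1 - (2 * M)^-1.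
have M0 : 0 < M by lra.
have sM : (1 - s) * M = 1 / 2 by rewrite /s; field; lra.
have s1 : s < 1 by rewrite /s gtrDl oppr_lt0 invr_gt0; lra.
have sgt : 0 < s by rewrite /s subr_gt0 invf_lt1; lra.
have s01 : 0 <= s < 1 by rewrite s1 ltW.
have sgt0 n : 0 < s ^+ n by rewrite exprn_gt0.
(* One step of the recursion: from the partial sum of order [n], the next function [h] and a radius
   [r] such that [h] is small outside the [r]-ball and the partial sum is under control inside it.
   Stating the requirements on the partial sum as premises makes the relation total for [choice]. *)
pose P (nF : nat * (R[i]^o -> R[i]^o)) (hr : (R[i]^o -> R[i]^o) * R) :=
  alg_A K nF.2 -> nF.2 z0 = (1 - s ^+ nF.1)%:C ->
  [/\ alg_A K hr.1, hr.1 z0 = 1, forall z, K z -> cmod (hr.1 z) <= M,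
      forall z, K z -> hr.2 <= cmod (z - z0) -> cmod (hr.1 z) <= 1 / 2 &
      hr.2 <= (2^-1) ^+ nF.1 /\ forall z, K z -> cmod (z - z0) < hr.2 ->
        cmod (nF.2 z) <= 1 - s ^+ nF.1 + (1 - s) / 4 * s ^+ nF.1].
have /choice[step stepP] : forall nF, exists hr, P nF hr.
  move=> [n F]; rewrite /P.
  have [[KF Fz0]|nF] := pselect (alg_A K F /\ F z0 = (1 - s ^+ n)%:C); last first.
    by exists ((fun=> 0), 0) => KF Fz0; exfalso; apply: nF; split.
  have e0 : 0 < (1 - s) / 4 * s ^+ n by rewrite mulr_gt0 // divr_gt0 // subr_gt0.
  have [/within_continuousP/(_ z0 Kz0 _ e0)[r r0 Fr] _] := KF.
  have [|h [Kh hz0 hM hfar]] := qp (Num.min r ((2^-1) ^+ n)).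
    by rewrite lt_min r0 exprn_gt0 // invr_gt0.
  exists (h, Num.min r ((2^-1) ^+ n)) => _ _; split; [exact: Kh|exact: hz0
    |exact: hM|exact: hfar|split].
    by rewrite ge_min lexx orbT.
  move=> z Kz; rewrite lt_min => /andP[/(Fr z Kz)/cmod_subr_lt + _].
  rewrite Fz0 cmod_real; first exact: ltW.
  by rewrite subr_ge0 exprn_ile1 // ltW.
pose F := fix F n : R[i]^o -> R[i]^o := if n is k.+1 then
  fun z => F k z + ((1 - s) * s ^+ k)%:C * (step (k, F k)).1 z else fun=> 0.
pose h n := (step (n, F n)).1; pose r n := (step (n, F n)).2.
have FS n z : F n.+1 z = F n z + ((1 - s) * s ^+ n)%:C * h n z by [].
have KF n : alg_A K (F n) /\ F n z0 = (1 - s ^+ n)%:C.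
  elim: n => [|n [KF Fz0]].
    by split; [exact: alg_A_cst|rewrite expr0 subrr].
  have [Kh hz0 _ _ _] := stepP (n, F n) KF Fz0; split.
    by apply: alg_A_add KF _; exact: alg_A_mul (alg_A_cst _ _) Kh.
  by rewrite FS Fz0 /h hz0 mulr1 -rmorphD exprS; congr (_%:C); ring.
have hP n : P (n, F n) (h n, r n).
  by move=> A B; exact: (stepP (n, F n) A B).
have {}hP n : [/\ forall z, K z -> cmod (h n z) <= M,
    forall z, K z -> r n <= cmod (z - z0) -> cmod (h n z) <= 1 / 2,
    r n <= (2^-1) ^+ n & forall z, K z -> cmod (z - z0) < r n ->
      cmod (F n z) <= 1 - s ^+ n + (1 - s) / 4 * s ^+ n].
  by have [A B] := KF n; have [_ _ hM hf [rn Fn]] := hP n A B; split.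
have c_ge0 n : 0 <= (1 - s) * s ^+ n by rewrite mulr_ge0 ?subr_ge0 ?ltW.
have tail n m z (C : R) : (n <= m)%N -> (forall j, (n <= j)%N -> cmod (h j z) <= C) ->
    cmod (F m z - F n z) <= C * (s ^+ n - s ^+ m).
  move=> /subnK <- hC; elim: (m - n)%N => [|k IH].
    by rewrite !subrr cmod0 mulr0.
  rewrite addSn FS addrAC; apply: le_trans (cmodD _ _) _.
  rewrite cmodM cmod_real //.
  have := ler_wpM2l (c_ge0 (k + n)%N) (hC (k + n)%N (leq_addl _ _)).
  by move: IH; rewrite exprS; lra.
have tail_le n m z (C : R) : (n <= m)%N -> 0 <= C ->
    (forall j, (n <= j)%N -> cmod (h j z) <= C) -> cmod (F m z - F n z) <= C * s ^+ n.
  move=> nm C0 hC; apply: le_trans (tail n m z C nm hC) _.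
  by rewrite ler_wpM2l // gerBl ltW.
have [|||f Kf fF] := @alg_A_uniform_limit _ K F (fun n => M * s ^+ n).
- by move=> n; have [] := KF n.
- move=> n m z nm Kz; apply: tail_le => //; first exact: ltW.
  by move=> j _; have [hM _ _ _] := hP j; exact: hM.
- move=> e e0; have := expr_small s01 (divr_gt0 e0 M0); apply: filterS => n.
  by rewrite ltr_pdivlMr // mulrC.
split; first exact: Kz0.
exists f; split; first exact: Kf.
  apply/eqP; rewrite -subr_eq0 -cmod_eq0 eq_le cmod_ge0 andbT.
  apply/ler_addgt0Pr => e e0; rewrite add0r.
  have /filter_ex[n sn] : \forall n \near \oo, s ^+ n < e / (2 * M + 1).
    by apply: expr_small => //; rewrite divr_gt0 //; lra.
  have := cmod_tri (f z0) (F n z0) 1; have := fF n z0 Kz0.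
  have -> : F n z0 - 1 = - (s ^+ n)%:C.
    by have [_ ->] := KF n; rewrite rmorphB rmorph1 addrAC subrr add0r.
  rewrite cmodN cmod_real; last exact: ltW.
  by move: sn; rewrite ltr_pdivlMr; lra.
move=> z Kz zz0; have dz : 0 < cmod (z - z0).
  by rewrite cmod_gt0 subr_eq0; apply/eqP.
(* Limits preserve only weak inequalities, so a bound [b < 1] independent of [m] is required. *)
suff [b [n [b1 Fb]]] : exists (b : R) n, b < 1 /\ forall m, (n <= m)%N -> cmod (F m z) <= b.
  have /filter_ex[m [sm nm]] : \forall m \near \oo, s ^+ m < (1 - b) / (2 * M) /\ (n <= m)%N.
    apply: filterI; last exact: nbhs_infty_ge.
    by apply: expr_small => //; rewrite divr_gt0 ?subr_gt0 //; lra.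
  have := fF m z Kz; have := Fb m nm; have := cmodD (f z - F m z) (F m z).
  by rewrite subrK; move: sm; rewrite ltr_pdivlMr; lra.
(* The radii need not decrease: descending from a large index, [n] is where the property of lying
   outside all later balls first fails for its predecessor. *)
have [n nfar nnear] : exists2 n, forall j, (n <= j)%N -> r j <= cmod (z - z0) &
    forall k, n = k.+1 -> cmod (z - z0) < r k.
  have h01 : 0 <= (2^-1 : R) < 1 by lra.
  have [N _ HN] := expr_small h01 dz.
  have : forall j, (N <= j)%N -> r j <= cmod (z - z0).
    by move=> j /HN /= /ltW; apply: le_trans; have [_ _ + _] := hP j.
  elim: (N) => [|k IH] Hk; first by exists 0%N.
  have [rk|rk] := ltP (cmod (z - z0)) (r k).
    by exists k.+1 => // j [<-].
  by apply: IH => j; rewrite leq_eqVlt => /predU1P[<-//|]; exact: Hk.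
have half0 : 0 <= 1 / 2 :> R by lra.
have hfar j : (n <= j)%N -> cmod (h j z) <= 1 / 2.
  by move=> /nfar; have [_ + _ _] := hP j; apply.
case: n nfar nnear hfar => [|k] nfar nnear hfar.
  exists (1 / 2), 0%N; split; first lra.
  move=> m _; have := tail_le 0%N m z (1 / 2) (leq0n m) half0 hfar.
  by rewrite subr0 expr0 mulr1.
(* The partial sum gives [1 - s^k + (1 - s) / 4 * s^k], the term of index [k] at most [s^k / 2] by
   [sM], and the tail at most [s^(k+1) / 2]; these add up to this value. *)
exists (1 - (1 - s) / 4 * s ^+ k), k.+1; split.
  by rewrite ltrBlDr ltrDl mulr_gt0 // divr_gt0 // subr_gt0.
move=> m km; have := tail_le k.+1 m z (1 / 2) km half0 hfar.
have [hM _ _ Fk] := hP k; have := Fk z Kz (nnear k erefl).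
have := ler_wpM2l (c_ge0 k) (hM z Kz).
have -> : (1 - s) * s ^+ k * M = 1 / 2 * s ^+ k by rewrite mulrAC sM.
have := cmodD (F m z - F k.+1 z) (F k.+1 z); rewrite subrK.
have := cmodD (F k z) (((1 - s) * s ^+ k)%:C * h k z).
by rewrite -FS cmodM cmod_real // exprS; have := sgt0 k; lra.
Qed.

Lemma frontier_subset K : compact K -> frontier K `<=` K.
Proof. by move=> /compact_closed_cmod/closure_id clK z [+ _]; rewrite -clK. Qed.

(** Quasi-peak functions with the uniform bound [146] yield one inclusion. Conversely a peak
    function attains its maximum modulus on the frontier, and only its peak point qualifies. *)
Lemma frontier_peak_points K : compact K -> connected (~` K) ->
  frontier K = peak_points K.
Proof.
move=> cK conK; apply/seteqP; split=> [z fz|z [Kz [f [Kf fz f1]]]].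
  have Kz := frontier_subset cK fz.
  apply: (@quasi_peak_peak _ _ 146) => //; first by rewrite ler1n.
  by move=> rho; apply: quasi_peak => //; case: fz.
have [u [Ku fu umax]] := frontier_maximum (ex_intro _ z Kz) cK Kf.
have [<-//|/eqP uz] := eqVneq u z.
by have := f1 u Ku uz; have := umax z Kz; rewrite fz cmod1; lra.
Qed.

(** A peak function has its peak as only maximum point. As [N] is arbitrary, this serves the Bishop
    and the Shilov boundary alike. *)
Lemma peak_points_boundary K N : compact K ->
  (forall f, alg_A K f -> max_set K f `&` N !=set0) -> peak_points K `<=` N.
Proof.
move=> cK KN z [Kz [f [Kf fz f1]]]; have [u [fu Nu]] := KN f Kf.
have [Ku umax] := proj1 (max_setP u (ex_intro _ z Kz) cK Kf) fu.
have [<-//|/eqP uz] := eqVneq u z.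
by have := f1 u Ku uz; have := umax z Kz; rewrite fz cmod1; lra.
Qed.

End PeakPoints.

Theorem theorem8p3 (R : realType) (K : set R[i]^o) (K_nonempty : K !=set0)
    (K_compact : compact K) (K_compl_connected : connected (~` K)) :
  exists M : set R[i]^o,
    [/\ is_bishop_minimal_boundary K M,
        frontier K = peak_points K,
        peak_points K = M &
        M = shilov_boundary K].
Proof.
have fP := frontier_peak_points K_compact K_compl_connected.
have fmax f : alg_A K f -> max_set K f `&` frontier K !=set0.
  move=> Kf; have [z [Kz fz zmax]] := frontier_maximum K_nonempty K_compact Kf.
  exists z; split; last exact: fz.
  by apply: (proj2 (max_setP z K_nonempty K_compact Kf)).
(* The frontier is itself a closed boundary by the maximum principle, and it lies in every boundary
   because its points are peak points. *)
exists (frontier K); split; [|exact: fP|by rewrite fP|].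
  split; first by split; [exact: frontier_subset|exact: fmax].
  by move=> N [_ KN]; rewrite fP; exact: peak_points_boundary.
apply/seteqP; split=> [z fz S [_ _ KS]|z].
  by apply: (peak_points_boundary K_compact KS); rewrite -fP.
apply; split; [|exact: frontier_subset|exact: fmax].
by apply: closedI; [exact: closed_closure|exact/open_closedC/open_interior].
Qed.
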